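(* Let $n \ge r \ge 1$ be integers. Let $\mu_{n,r}:\mathbb{C}^n\times\mathbb{C}^r\to\mathbb{C}^{n+r}$ be the multiplication map of monic polynomials of degrees $n$ and $r$, let $I(\mu_{n,r})$ be the ideal of germs at the origin generated by its components, and let $TB(I(\mu_{n,r}))$ be its Thom-Boardman symbol. Then $$TB(I(\mu_{n,r})) = I(n,r),$$ where $I(n,r)$ is the tuple obtained from the Euclidean algorithm applied to $n$ and $r$.
   Context: Multiplication map: write $f(x)=x^n+a_{n-1}x^{n-1}+\cdots+a_0$, $g(x)=x^r+b_{r-1}x^{r-1}+\cdots+b_0$ and $f(x)g(x)=x^{n+r}+c_{n+r-1}x^{n+r-1}+\cdots+c_0$, so each $c_j$ is a polynomial in $(a_0,\dots,a_{n-1},b_0,\dots,b_{r-1})$. The map is $\mu_{n,r}(a_0,\dots,a_{n-1},b_0,\dots,b_{r-1})=(c_{n+r-1},\dots,c_0)$. Let $\mathcal{A}$ be the algebra of germs at the origin of holomorphic functions on $\mathbb{C}^n\times\mathbb{C}^r$, and $I(\mu_{n,r})\subset\mathcal{A}$ the ideal generated by $c_0,\dots,c_{n+r-1}$. Thom-Boardman symbol: let $J\subset\mathcal{A}$ be a proper ideal. For $k\ge 1$ the Jacobian extension $\Delta_k J$ is the ideal generated by $J$ and all $k\times k$ minors of the matrices of first partial derivatives (with respect to the $n+r$ coordinates) of finite families of functions in $J$ (there are no such minors if $k>n+r$, so $\Delta_{n+r+1}J=J$). Put $\Delta^i J=\Delta_{n+r-i+1}J$. The rank of $J$ is the maximal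 number of elements of $J$ with linearly independent differentials at the origin, and $\operatorname{corank}(J)=n+r-\operatorname{rank}(J)$. The symbol $TB(J)$ is the sequence $(i_1,i_2,\dots)$ with $i_1=\operatorname{corank}(J)$ and $i_{k+1}=\operatorname{corank}(\Delta^{i_k}\cdots\Delta^{i_1}J)$ for $k\ge1$, truncated after its last nonzero entry. Euclidean tuple: write the Euclidean algorithm as $n=q_1r+r_1$ ($0<r_1<r$), $r=q_2r_1+r_2$ ($0<r_2<r_1$), $\dots$, $r_{k-1}=q_{k+1}r_k$ ($0<r_k<r_{k-1}$), the last step having zero remainder (with $r_0=r$, $r_{-1}=n$; if $r\mid n$ the only step is $n=q_1r$). Then $I(n,r)=(r,\dots,r,r_1,\dots,r_1,\dots,r_k,\dots,r_k)$, where $r$ is repeated $q_1$ times and $r_i$ is repeated $q_{i+1}$ times. *)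

(* Defs.v *)
From HB Require Import structures.
From mathcomp Require Import all_boot all_order all_algebra.
From mathcomp Require Import complex.
From mathcomp Require Import all_classical all_reals all_analysis.

Set Implicit Arguments.
Unset Strict Implicit.
Unset Printing Implicit Defensive.

Import Order.TTheory GRing.Theory Num.Theory.
Import numFieldNormedType.Exports.

Local Open Scope classical_set_scope.
Local Open Scope ring_scope.

(* The field of complex numbers; declaring it as a numClosedFieldType gives it
   the topology and the normed-module structure of the library.  Norms take
   values in C itself and x <= y means that y - x is real and nonnegative. *)
Definition Cfield (R : realType) : numClosedFieldType := R[i].

Section Germs.
Variables (R : realType) (N : nat).
Local Notation C := (Cfield R).
Local Notation V := 'rV[C]_N.

Definition monomial (alpha : {ffun 'I_N -> nat}) (h : V) : C :=
  \prod_(i < N) h 0 i ^+ alpha i.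

(* The multi-indices alpha with alpha_i < k for all i exhaust all multi-indices
   as k grows; for an absolutely convergent series the value is the limit of
   the sums over these boxes. *)
Definition box_sum (t : {ffun 'I_N -> nat} -> C) (k : nat) : C :=
  \sum_(alpha : {ffun 'I_N -> 'I_k}) t [ffun i => alpha i : nat].

Definition abs_series_cvg (t : {ffun 'I_N -> nat} -> C) (l : C) : Prop :=
  (exists M : C, forall k, box_sum (fun alpha => `|t alpha|) k <= M) /\
  (box_sum t k @[k --> \oo] --> l).

Definition power_series_at (f : V -> C) (z : V) : Prop :=
  exists a : {ffun 'I_N -> nat} -> C,
    \forall w \near z,
      abs_series_cvg (fun alpha => a alpha * monomial alpha (w - z)) (f w).

(* f is holomorphic on some open neighbourhood of the origin: it is the sum of
   a convergent power series around each point of that neighbourhood. *)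
Definition holomorphic_near0 (f : V -> C) : Prop :=
  \forall z \near (0 : V), power_series_at f z.

(* Germs at the origin are handled through their representatives, total
   functions V -> C that are holomorphic near 0; two of them represent the same
   germ when they agree near 0.  A set of germs is the set of all its
   representatives. *)
Definition ideal_gen (S : set (V -> C)) : set (V -> C) :=
  [set f | exists m (h s : 'I_m -> V -> C),
    [/\ forall i, holomorphic_near0 (h i),
        forall i, S (s i) &
        \forall z \near (0 : V), f z = \sum_(i < m) h i z * s i z]].

Definition jacobian_mx m (F : 'I_m -> V -> C) (z : V) : 'M[C]_(m, N) :=
  \matrix_(i < m, j < N) ('D_(delta_mx 0 j) (F i : V -> C^o) z : C).

Definition jacobian_minors (J : set (V -> C)) (k : nat) : set (V -> C) :=
  [set g | exists m (F : 'I_m -> V -> C)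
      (rows : 'I_k -> 'I_m) (cols : 'I_k -> 'I_N),
    [/\ forall i, J (F i),
        {homo rows : i j / (i < j)%N},
        {homo cols : i j / (i < j)%N} &
        g = fun z => \det (mxsub rows cols (jacobian_mx F z))]].

(* Delta_k J *)
Definition jacobian_ext (k : nat) (J : set (V -> C)) : set (V -> C) :=
  ideal_gen (J `|` jacobian_minors J k).

(* Delta^i J; used for i <= N only. *)
Definition jacobian_ext_up (i : nat) (J : set (V -> C)) : set (V -> C) :=
  jacobian_ext (N - i + 1)%N J.

(* No more than N differentials can be independent, whence the range of k. *)
Definition ideal_rank (J : set (V -> C)) : nat :=
  \max_(k < N.+1 | `[< exists F : 'I_k -> V -> C,
    (forall i, J (F i)) /\ row_free (jacobian_mx F 0) >]) k.

Definition ideal_corank (J : set (V -> C)) : nat := (N - ideal_rank J)%N.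

(* Delta^{i_k} ... Delta^{i_1} J *)
Fixpoint TB_ideal (J : set (V -> C)) (k : nat) : set (V -> C) :=
  if k is k'.+1 then
    jacobian_ext_up (ideal_corank (TB_ideal J k')) (TB_ideal J k')
  else J.

(* i_{k+1}, for k = 0, 1, ... *)
Definition TB_entry (J : set (V -> C)) (k : nat) : nat :=
  ideal_corank (TB_ideal J k).

End Germs.

(* s is the sequence u truncated after its last nonzero entry. *)
Definition is_truncation (u : nat -> nat) (s : seq nat) : Prop :=
  (forall k, u k = nth 0%N s k) /\ last 1%N s != 0%N.

(* TB(J) = s.  This is a relation because TB(J) is an infinite sequence when
   its entries never reach 0, as for J = 0. *)
Definition TB_symbol (R : realType) (N : nat)
    (J : set ('rV[Cfield R]_N -> Cfield R)) (s : seq nat) : Prop :=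
  is_truncation (TB_entry J) s.

Section Multiplication.
Variables (R : realType) (n r : nat).
Local Notation C := (Cfield R).

Definition monic_poly d (a : 'rV[C]_d) : {poly C} := 'X^d + rVpoly a.

(* A point of C^n x C^r is the row (a_0, ..., a_{n-1}, b_0, ..., b_{r-1});
   rev_ord lists the coefficients as (c_{n+r-1}, ..., c_0). *)
Definition mult_map (z : 'rV[C]_(n + r)) : 'rV[C]_(n + r) :=
  \row_(j < n + r) (monic_poly (lsubmx z) * monic_poly (rsubmx z))`_(rev_ord j).

Definition mult_ideal : set ('rV[C]_(n + r) -> C) :=
  ideal_gen [set g | exists j, g = fun z => mult_map z 0 j].

End Multiplication.

Arguments mult_ideal : clear implicits.

(* The first argument only bounds the number of division steps; remainders
   decrease strictly, so r steps suffice for the pair (n, r). *)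
Fixpoint euclid_steps (fuel n r : nat) : seq nat :=
  if fuel is fuel'.+1 then
    if r == 0%N then [::] else nseq (n %/ r) r ++ euclid_steps fuel' r (n %% r)
  else [::].

Definition euclid_tuple (n r : nat) : seq nat := euclid_steps r n r.

(* Main.v *)
(* Let p, q be monic of degrees s >= t whose coefficients, together with some
   functions y, form a polynomial coordinate system of C^N, and let J be the ideal
   generated by y and by the coefficients of p^a q^b - x^N, where as + bt = N.
   Since d(p^a q^b) = p^(a-1) q^(b-1) (a q dp + b p dq), the ideal J has corank t
   at the point p = x^s, q = x^t.  Write p = h q + rho with deg rho < t.  Modulo rho
   the differential becomes p^(a-1) q^b (a dp + b h dq), which factors through
   polynomials of degree < s: all minors of size N - t + 1 of families in J
   vanish modulo rho.  Conversely, along the coordinate vector fields of y, of p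
   and of the constant coefficient of q, a suitable family in J has a triangular
   Jacobian matrix whose last pivot runs through the coefficients of
   b p^(a-1) q^(b-1) rho.  Hence Delta^t J is generated by y, rho and the coefficients
   of h^a q^(a+b) - x^N; the new coordinates are (y, rho), h and q, and the pair of
   degrees (s, t) has become (s - t, t).  Starting from (n, r), this is the
   Euclidean algorithm by subtraction.

   To avoid products of convergent power series, upper bounds on the ideals are
   proved in the larger ring of germs all of whose iterated partial derivatives
   exist near 0, and membership is proved with polynomial coefficients only. *)
Require Import Defs.
From HB Require Import structures.
From mathcomp Require Import all_boot all_order all_algebra all_fingroup.
From mathcomp Require Import complex zify ring.
From mathcomp Require Import all_classical all_reals all_analysis.

Set Implicit Arguments.
Unset Strict Implicit.
Unset Printing Implicit Defensive.

Import Order.TTheory GRing.Theory Num.Theory.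
Import Pdiv.CommonRing Pdiv.RingMonic.
Import numFieldNormedType.Exports.

Local Open Scope classical_set_scope.
Local Open Scope ring_scope.

(** * Ideals, minors, monic division, derivations *)

(* [S] is the set of scalars: the ideals below are ideals of a subring of [R]. *)
Definition is_ideal (R : comNzRingType) (S I : R -> Prop) :=
  [/\ I 0, forall x y, I x -> I y -> I (x + y) &
      forall c x, S c -> I x -> I (c * x)].

Section Ideals.
Variables (R : comNzRingType) (S I : R -> Prop).
Hypotheses (S1 : S 1) (SN1 : S (-1)) (SM : forall x y, S x -> S y -> S (x * y)).
Hypothesis HI : is_ideal S I.

Lemma ideal_sum (J : Type) (r : seq J) (Q : pred J) (F : J -> R) :
  (forall i, Q i -> I (F i)) -> I (\sum_(i <- r | Q i) F i).
Proof. by case: HI => I0 ID _ IF; elim/big_ind: _ => // x y; apply: ID. Qed.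

Lemma ideal_opp x : I x -> I (- x).
Proof. by case: HI => _ _ IM Ix; rewrite -mulN1r; apply: IM. Qed.

Lemma ideal_cong x y : I (x - y) -> I x <-> I y.
Proof.
case: (HI) => _ ID _ Ixy; split => [Ix|Iy]; last first.
  by rewrite -(subrK y x); apply: ID.
by rewrite -(subrK x y); apply: ID => //; rewrite -opprB; apply: ideal_opp.
Qed.

(** Products of congruent entries are congruent by telescoping, x1 y1 - x2 y2 = y1 (x1 - x2) + x2
    (y1 - y2). The entries must lie in [S] because they become multipliers of elements of the
    ideal. *)
Lemma det_cong k (A B : 'M[R]_k) :
  (forall i j, S (A i j)) -> (forall i j, S (B i j)) ->
  (forall i j, I (A i j - B i j)) -> I (\det A - \det B).
Proof.
move=> SA SB AB; have [I0 ID IM] := HI.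
rewrite /determinant -sumrB; apply: ideal_sum => s _; rewrite -mulrBr.
apply: (IM); first by case: odd_perm; rewrite ?expr1 ?expr0.
suff: [/\ S (\prod_i A i (s i)), S (\prod_i B i (s i)) &
          I (\prod_i A i (s i) - \prod_i B i (s i))] by case.
apply: (big_ind2 (fun x y => [/\ S x, S y & I (x - y)])) => //.
- by rewrite subrr.
- move=> x1 x2 y1 y2 [Sx1 Sx2 Ix] [Sy1 Sy2 Iy].
  split; [exact: SM|exact: SM|].
  have -> : x1 * y1 - x2 * y2 = y1 * (x1 - x2) + x2 * (y1 - y2).
    by rewrite !mulrBr [y1 * x1]mulrC [y1 * x2]mulrC addrA subrK.
  by apply: ID; apply: (IM).
Qed.

End Ideals.

(** * Minors of a product: Cauchy-Binet *)

Section Minors.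
Variable R : comNzRingType.

(** Cauchy-Binet before terms are grouped: multilinear expansion gives a sum over all maps [f],
    injective or not. *)
Lemma det_mulmx_colsub k N (A : 'M[R]_(k, N)) (B : 'M[R]_(N, k)) :
  \det (A *m B) =
    \sum_(f : {ffun 'I_k -> 'I_N}) (\prod_i B (f i) i) * \det (colsub f A).
Proof.
rewrite -det_tr trmx_mul [LHS]/determinant.
under [RHS]eq_bigr do rewrite -det_tr /determinant mulr_sumr.
rewrite exchange_big /=; apply: eq_bigr => s _.
under [RHS]eq_bigr do rewrite mulrCA -big_split /=.
rewrite -mulr_sumr; congr (_ * _).
under [LHS]eq_bigr do rewrite mxE.
by rewrite bigA_distr_bigA /=; apply: eq_bigr => f _; apply: eq_bigr => i _; rewrite !mxE.
Qed.

Lemma sort_cols k N (f : 'I_k -> 'I_N) : injective f ->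
  exists s : 'S_k, {homo (f \o s) : i j / (i < j)%N}.
Proof.
move=> f_inj; pose t := [tuple f i | i < k].
pose le (i j : 'I_N) := (i <= j)%N.
have le_total : total le by move=> i j; apply: leq_total.
have le_trans : transitive le by move=> ? ? ?; apply: leq_trans.
have /tuple_permP[s sE] : perm_eq (sort le t) t by rewrite perm_sort.
exists s => i j ij /=.
have nthE (l : 'I_k) : nth (f i) (sort le t) l = f (s l).
  rewrite sE (nth_map l) ?size_enum_ord// nth_ord_enum tnth_mktuple//.
have szk : size (sort le t) = k by rewrite size_sort size_tuple.
rewrite -(nthE i) -(nthE j) ltn_neqAle; apply/andP; split.
  rewrite !nthE; apply/eqP => /val_inj/f_inj/perm_inj eij.
  by rewrite eij ltnn in ij.
have srt := sort_sorted le_total t.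
by apply: (sorted_leq_nth le_trans _ (f i) srt); rewrite ?inE ?szk ?(ltnW ij)//;
  move=> ?; apply: leqnn.
Qed.

(** In the Cauchy-Binet sum a non-injective map repeats a column and contributes 0; an injective one
    gives, up to sign, a minor with increasing columns. This carries minors in the coordinate
    directions over to arbitrary vector fields. *)
Lemma minors_mulmx (S I : R -> Prop) k N (A : 'M[R]_(k, N)) (B : 'M[R]_(N, k)) :
  S 1 -> S (-1) -> (forall x y, S x -> S y -> S (x * y)) -> is_ideal S I ->
  (forall i j, S (B i j)) ->
  (forall f : 'I_k -> 'I_N, {homo f : i j / (i < j)%N} -> I (\det (colsub f A))) ->
  I (\det (A *m B)).
Proof.
move=> S1 SN1 SM HI SB IA; have [I0 _ IM] := HI.
rewrite det_mulmx_colsub; apply: (ideal_sum HI) => f _; apply: (IM).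
  by elim/big_ind: _.
have [/injectiveP f_inj|] := boolP (injectiveb f); last first.
  case/injectivePn=> i [j ij fij]; rewrite -det_tr (determinant_alternate ij) //.
  by move=> l; rewrite !mxE fij.
have [s fs] := sort_cols f_inj.
have -> : colsub f A = col_perm s^-1 (colsub (f \o s) A).
  by apply/matrixP => i j; rewrite !mxE /= permKV.
rewrite col_permE det_mulmx det_perm mulrC; apply: IM; last exact: IA.
by case: odd_perm; rewrite ?expr1 ?expr0.
Qed.

End Minors.

Lemma det_mulmx_thin (F : fieldType) k l (X : 'M[F]_(k, l)) (Y : 'M[F]_(l, k)) :
  (l < k)%N -> \det (X *m Y) = 0.
Proof.
move=> lk; apply/eqP; rewrite -[_ == 0]negbK -unitfE -unitmxE -row_free_unit.
by rewrite -row_leq_rank -ltnNge (leq_ltn_trans (mulmx_max_rank _ _)).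
Qed.

(** * Division by a monic polynomial, and modulo an ideal of coefficients *)

Section MonicDivision.
Variable R : comNzRingType.
Implicit Types p q e : {poly R}.

Lemma rdivp_unique q e p (r : {poly R}) : q \is monic -> p = e * q + r -> (size r < size q)%N ->
  rdivp p q = e /\ rmodp p q = r.
Proof.
by move=> qm -> rq; rewrite rdivp_addl_mul_small // rmodp_addl_mul_small.
Qed.

Lemma rdivpD_monic q p1 p2 : q \is monic ->
  rdivp (p1 + p2) q = rdivp p1 q + rdivp p2 q.
Proof.
move=> qm; suff [] : rdivp (p1 + p2) q = rdivp p1 q + rdivp p2 q /\
  rmodp (p1 + p2) q = rmodp p1 q + rmodp p2 q by [].
apply: rdivp_unique => //.
  by rewrite {1}(rdivp_eq qm p1) {1}(rdivp_eq qm p2) mulrDl addrACA.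
rewrite (leq_ltn_trans (size_polyD _ _)) // gtn_max.
by rewrite !ltn_rmodpN0 ?monic_neq0.
Qed.

Lemma rdivpZ_monic q c p : q \is monic -> rdivp (c *: p) q = c *: rdivp p q.
Proof.
move=> qm; suff [] : rdivp (c *: p) q = c *: rdivp p q /\
  rmodp (c *: p) q = c *: rmodp p q by [].
apply: rdivp_unique => //.
  by rewrite {1}(rdivp_eq qm p) scalerDr scalerAl.
by rewrite (leq_ltn_trans (size_scale_leq _ _)) // ltn_rmodpN0 ?monic_neq0.
Qed.

End MonicDivision.

Section PolyIdeal.
Variables (R : comNzRingType) (I : R -> Prop).
Hypothesis HI : is_ideal (fun=> True) I.
Implicit Types p q e : {poly R}.

Definition coef_in p := forall i, I p`_i.

Lemma coef_in0 : coef_in 0.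
Proof. by move=> i; rewrite coef0; case: HI. Qed.

Lemma coef_inD p q : coef_in p -> coef_in q -> coef_in (p + q).
Proof. by case: HI => _ ID _ Ip Iq i; rewrite coefD; apply: ID. Qed.

Lemma coef_inN p : coef_in p -> coef_in (- p).
Proof. by move=> Ip i; rewrite coefN; apply: (ideal_opp _ HI). Qed.

Lemma coef_inM p q : coef_in q -> coef_in (p * q).
Proof.
by case: (HI) => _ _ IM Iq i; rewrite coefM; apply: (ideal_sum HI) => j _; apply: IM.
Qed.

Lemma coef_in_sum (J : Type) (r : seq J) (Q : pred J) (F : J -> {poly R}) :
  (forall i, Q i -> coef_in (F i)) -> coef_in (\sum_(i <- r | Q i) F i).
Proof. by move=> IF; elim/big_ind: _ => //; [apply: coef_in0|apply: coef_inD]. Qed.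

(** Quotient and remainder by a monic polynomial are linear in the dividend; expanding [p] in powers
    of X makes their coefficients combinations of those of [p]. *)
Lemma coef_in_div q p : q \is monic -> coef_in p ->
  coef_in (rdivp p q) /\ coef_in (rmodp p q).
Proof.
case: (HI) => _ _ IM qm Ip; rewrite -(coefK p) poly_def; split.
  rewrite (big_morph ((@rdivp R)^~ q) (fun a b => rdivpD_monic a b qm) (rdiv0p q)).
  by apply: coef_in_sum => i _ j; rewrite rdivpZ_monic // coefZ mulrC; apply: IM.
rewrite rmodp_sum //; apply: coef_in_sum => i _ j.
by rewrite rmodpZ // coefZ mulrC; apply: IM.
Qed.

(* Euclidean division by a monic polynomial is unique modulo [I]. *)
Lemma coef_in_cancel q e (r : {poly R}) : q \is monic -> (size r < size q)%N ->
  coef_in (e * q + r) -> coef_in e /\ coef_in r.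
Proof.
move=> qm rq /(coef_in_div qm).
by have [-> ->] := rdivp_unique qm (erefl (e * q + r)) rq.
Qed.

End PolyIdeal.

(** * Derivations and their coefficientwise extension to polynomials *)

Definition derivation (R : comNzRingType) (D : R -> R) :=
  (forall x y, D (x + y) = D x + D y) /\ (forall x y, D (x * y) = D x * y + x * D y).

Section Derivations.
Variables (R : comNzRingType) (D : R -> R).
Hypothesis HD : derivation D.

Lemma der0 : D 0 = 0.
Proof. by case: HD => DD _; apply: (addIr (D 0)); rewrite -DD !add0r. Qed.

Lemma der1 : D 1 = 0.
Proof.
by case: HD => _ DM; apply: (addIr (D 1)); rewrite add0r -{3}(mulr1 1) DM mulr1 mul1r.
Qed.

Lemma der_opp x : D (- x) = - D x.
Proof. by case: (HD) => DD _; apply/eqP; rewrite -addr_eq0 -DD addNr der0 eqxx. Qed.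

Lemma derB x y : D (x - y) = D x - D y.
Proof. by case: (HD) => DD _; rewrite DD der_opp. Qed.

Lemma der_sum (J : Type) (r : seq J) (Q : pred J) (F : J -> R) :
  D (\sum_(i <- r | Q i) F i) = \sum_(i <- r | Q i) D (F i).
Proof. by case: (HD) => DD _; apply: (big_morph D DD der0). Qed.

Lemma derX x n : D (x ^+ n) = (x ^+ n.-1 * D x) *+ n.
Proof.
case: (HD) => _ DM; elim: n => [|n IH]; first by rewrite expr0 der1 mulr0n.
rewrite exprS DM IH /= mulrSr addrC; congr (_ + _); last exact: mulrC.
case: n {IH} => [|n]; first by rewrite !mulr0n mulr0.
by rewrite -mulrnAr -mulrnAr mulrA -exprS.
Qed.

Definition dpoly (p : {poly R}) : {poly R} := map_poly D p.

Lemma coef_dpoly p i : (dpoly p)`_i = D p`_i.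
Proof. by rewrite coef_map_id0 // der0. Qed.

Lemma dpoly_derivation : derivation dpoly.
Proof.
case: (HD) => DD DM; split => p q; apply/polyP => i.
  by rewrite coefD !coef_dpoly coefD DD.
rewrite coef_dpoly coefM coefD !coefM der_sum -big_split /=.
by apply: eq_bigr => j _; rewrite DM !coef_dpoly.
Qed.

Lemma dpolyXn n : dpoly 'X^n = 0.
Proof.
apply/polyP => i; rewrite coef_dpoly coefXn coef0.
by case: eqP => _; rewrite ?der0 ?der1.
Qed.

Lemma size_dpoly_monic p : p \is monic -> (size (dpoly p) <= (size p).-1)%N.
Proof.
move=> pm; apply/leq_sizeP => j; rewrite coef_dpoly leq_eqVlt => /orP[/eqP <-|].
  by rewrite -lead_coefE (monicP pm) der1.
by move=> h; rewrite nth_default ?der0 // -(prednK (_ : 0 < size p)%N) // size_poly_gt0 monic_neq0.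
Qed.

Lemma size_dpoly p : (size (dpoly p) <= size p)%N.
Proof. by apply/leq_sizeP => j h; rewrite coef_dpoly nth_default ?der0. Qed.

End Derivations.

(** * One step of the Euclidean algorithm *)

Lemma size_mulrn_leq (R : nzRingType) (p : {poly R}) n : (size (p *+ n) <= size p)%N.
Proof. by apply/leq_sizeP => i pi; rewrite coefMn nth_default // mul0rn. Qed.

(** With [A] = p^(a-1), [B] = q^(b-1), [u] = dp, [v] = dq and p = h q + r, the left side is d(p^a
    q^b); the right side separates a multiple of p^(a-1) q^b from a multiple of [r]. *)
Lemma leibniz_expand (R : comNzRingType) (h q r A B u v : R) a b :
  (A * u) *+ a * (q * B) + (h * q + r) * A * ((B * v) *+ b) =
  A * (q * B) * (u *+ a + h * v *+ b) + A * B * r * v *+ b.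
Proof.
rewrite -(mulr_natl (A * u)) -(mulr_natl (B * v)) -(mulr_natl u) -(mulr_natl (h * v)).
by rewrite -(mulr_natl (A * B * r * v)); ring.
Qed.

(** * Finitely generated ideals and triangular determinants modulo an ideal *)

Section Span.
Variable R : comNzRingType.
Implicit Types G : seq R.

Definition ideal_span G (f : R) := exists c : nat -> R, f = \sum_(i < size G) c i * G`_i.

Lemma span_ideal G : is_ideal (fun=> True) (ideal_span G).
Proof.
split.
- by exists (fun=> 0); rewrite big1 // => i _; rewrite mul0r.
- move=> _ _ [c ->] [c' ->]; exists (fun i => c i + c' i).
  by rewrite -big_split; apply: eq_bigr => i _; rewrite mulrDl.
- move=> b _ _ [c ->]; exists (fun i => b * c i).
  by rewrite mulr_sumr; apply: eq_bigr => i _; rewrite mulrA.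
Qed.

Lemma span_nth G i : ideal_span G G`_i.
Proof.
have [lt|ge] := ltnP i (size G); last first.
  by rewrite nth_default //; case: (span_ideal G).
exists (fun j => (j == i)%:R); rewrite (bigD1 (Ordinal lt)) //= eqxx mul1r big1 ?addr0 //.
by move=> j ji; rewrite (negPf (_ : val j != i)) ?mul0r.
Qed.

Lemma span_min G (I : R -> Prop) : is_ideal (fun=> True) I ->
  (forall i, (i < size G)%N -> I G`_i) -> forall f, ideal_span G f -> I f.
Proof.
move=> HI IG _ [c ->]; apply: (ideal_sum HI) => i _.
by case: HI => _ _ IM; apply: IM => //; apply: IG.
Qed.

End Span.

(** Modulo the ideal [M] is upper triangular. Its entries above the diagonal are unconstrained, so
    the comparison matrix [T] copies them. *)
Lemma det_triangular_cong (R : comNzRingType) (I : R -> Prop) k (M : 'M[R]_k) piv :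
  is_ideal (fun=> True) I ->
  (forall i j : 'I_k, (j <= i)%N -> I (M i j - piv i *+ (i == j))) ->
  I (\det M - \prod_i piv i).
Proof.
move=> HI IM; pose T := \matrix_(i, j) if (j <= i)%N then piv i *+ (i == j) else M i j.
have -> : \prod_i piv i = \det T.
  rewrite -det_tr det_trig; last first.
    apply/is_trig_mxP => i j ij; rewrite !mxE (ltnW ij).
    by rewrite (negPf (_ : j != i)) // -val_eqE /= gtn_eqF.
  by apply: eq_bigr => i _; rewrite !mxE leqnn eqxx.
apply: (det_cong _ _ _ HI) => // i j; rewrite !mxE; case: ifP => ji; first exact: IM.
by rewrite subrr; case: HI.
Qed.

(** * Stages of the algorithm, over a ring with derivations and an evaluation *)

Section Stages.
Variables (P : comNzRingType) (N : nat) (d : 'I_N -> P -> P).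
Hypothesis Hd : forall j, derivation (d j).
Variables (K : numFieldType) (ev : {rmorphism P -> K}).
Hypothesis natV : forall m, (0 < m)%N -> exists u : P, u * m%:R = 1.
Implicit Types (p q : {poly P}) (y : seq P).

Definition field_act (w : 'I_N -> P) (f : P) := \sum_j w j * d j f.

Lemma field_act_derivation w : derivation (field_act w).
Proof.
split=> f g; rewrite /field_act.
  by rewrite -big_split; apply: eq_bigr => j _; case: (Hd j) => dD _; rewrite dD mulrDr.
rewrite mulr_suml mulr_sumr -big_split; apply: eq_bigr => j _ /=.
by case: (Hd j) => _ dM; rewrite dM mulrDr !mulrA [w j * f]mulrC.
Qed.

Definition stage_poly p q a b := p ^+ a * q ^+ b - 'X^N.

(** At a stage p^a q^b is monic of degree N, so its leading term cancels X^N and the coefficients of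
    index below N are all there are. *)
Definition gens y p q a b := y ++ [seq (stage_poly p q a b)`_i | i <- iota 0 N].

(* The last condition says that the elements of [y] and the nonleading
   coefficients of [p] and [q] form a coordinate system. *)
Record stage y p q s t a b : Prop := Stage {
  stage_pm : p \is monic;
  stage_qm : q \is monic;
  stage_ps : size p = s.+1;
  stage_qs : size q = t.+1;
  stage_a : (0 < a)%N;
  stage_b : (0 < b)%N;
  stage_deg : (a * s + b * t = N)%N;
  stage_dim : (size y + s + t = N)%N;
  stage_y0 : forall i, ev y`_i = 0;
  stage_p0 : map_poly ev p = 'X^s;
  stage_q0 : map_poly ev q = 'X^t;
  stage_coord : forall (eta : nat -> P) (pi kappa : {poly P}),
    (size pi <= s)%N -> (size kappa <= t)%N ->
    exists w, [/\ forall i, (i < size y)%N -> field_act w y`_i = eta i,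
      dpoly (field_act w) p = pi & dpoly (field_act w) q = kappa] }.

Lemma stage_polyC p q a b : stage_poly p q a b = stage_poly q p b a.
Proof. by rewrite /stage_poly mulrC. Qed.

Lemma stageC y p q s t a b : stage y p q s t a b -> stage y q p t s b a.
Proof.
case=> pm qm ps qs a0 b0 deg dim y0 p0 q0 co; split => //; [lia|lia|].
move=> eta pi kappa pis kaps; have [w [? ? ?]] := co eta kappa pi kaps pis.
by exists w.
Qed.

Definition next_y y p q t := y ++ [seq (rmodp p q)`_i | i <- iota 0 t].

Lemma size_monicX (u : {poly P}) k : u \is monic ->
  size (u ^+ k) = ((size u).-1 * k).+1.
Proof.
move=> um; elim: k => [|k IH]; first by rewrite expr0 size_poly1 muln0.
rewrite exprSr size_Mmonic ?monic_neq0 ?monic_exp // IH mulnS.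
by have : (0 < size u)%N; [rewrite size_poly_gt0 monic_neq0|lia].
Qed.

Lemma size_monicXM (u v : {poly P}) k l : u \is monic -> v \is monic ->
  size (u ^+ k * v ^+ l) = ((size u).-1 * k + (size v).-1 * l).+1.
Proof.
move=> um vm; rewrite size_Mmonic ?monic_neq0 ?monic_exp // !size_monicX //.
by rewrite addSn addnS.
Qed.

Lemma size_stage_poly y p q s t a b : stage y p q s t a b -> (size (stage_poly p q a b) <= N)%N.
Proof.
move=> St; have [pm qm] := conj (stage_pm St) (stage_qm St).
have mon : p ^+ a * q ^+ b \is monic by rewrite monicMl ?monic_exp.
have sz : size (p ^+ a * q ^+ b) = N.+1.
  rewrite size_monicXM // (stage_ps St) (stage_qs St) /= -(stage_deg St); lia.
apply/leq_sizeP => j; rewrite leq_eqVlt coefB coefXn => /orP[/eqP <-|Nj].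
  by move: mon; rewrite monicE lead_coefE sz eqxx => /eqP ->; rewrite subrr.
by rewrite nth_default ?sz // gtn_eqF // subrr.
Qed.

(** Valid for every index: past the end of the list both sides are the default 0, which is where the
    degree bound enters. *)
Lemma gens_nth (z : seq P) (u v : {poly P}) k l i : (size (stage_poly u v k l) <= N)%N ->
  (gens z u v k l)`_i = if (i < size z)%N then z`_i else (stage_poly u v k l)`_(i - size z).
Proof.
move=> sQ; rewrite nth_cat; case: ltnP => // iz.
have [it|ti] := ltnP (i - size z) N.
  by rewrite (nth_map 0%N) ?size_iota // nth_iota // add0n.
by rewrite !nth_default ?size_map ?size_iota // (leq_trans sQ).
Qed.

Lemma size_gens (z : seq P) (u v : {poly P}) k l :
  size (gens z u v k l) = (size z + N)%N.
Proof. by rewrite size_cat size_map size_iota. Qed.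

(** * One subtraction step, from (p, q) to (h, q) with p = h q + rho *)

Section Step.
Variables (y : seq P) (p q : {poly P}) (s t a b : nat).
Hypothesis St : stage y p q s t a b.
Hypothesis ts : (t <= s)%N.

Let h := rdivp p q.
Let rho := rmodp p q.
Let y' := next_y y p q t.
Let Q := stage_poly p q a b.
Let Q' := stage_poly h q a (a + b).
Let G := gens y p q a b.
Let G' := gens y' h q a (a + b).
Let pm := stage_pm St.
Let qm := stage_qm St.

Lemma pE : p = h * q + rho. Proof. exact: rdivp_eq. Qed.

Lemma size_rho : (size rho <= t)%N.
Proof. by rewrite -ltnS -(stage_qs St) ltn_rmodpN0 ?monic_neq0. Qed.

Lemma size_y' : size y' = (size y + t)%N.
Proof. by rewrite size_cat size_map size_iota. Qed.

Lemma size_hq : size (h * q) = s.+1.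
Proof.
have -> : h * q = p - rho by rewrite pE addrK.
by rewrite size_polyDl ?(stage_ps St) // size_polyN (leq_ltn_trans size_rho) // ltnS.
Qed.

Lemma size_h : size h = (s - t).+1.
Proof.
have h0 : h != 0.
  by apply/eqP => h0; have := size_hq; rewrite h0 mul0r size_poly0.
have := size_hq; rewrite size_Mmonic // (stage_qs St) addnS /= => E.
lia.
Qed.

Lemma h_monic : h \is monic.
Proof.
rewrite monicE -(lead_coef_Mmonic h qm).
have -> : h * q = p - rho by rewrite pE addrK.
by rewrite lead_coefDl ?(monicP pm) // size_polyN (stage_ps St) ltnS (leq_trans size_rho).
Qed.

(** At the base point p = h q + rho becomes a division of X^s by X^t, whose quotient and remainder
    are unique. *)
Lemma ev_h_rho : map_poly ev h = 'X^(s - t) /\ map_poly ev rho = 0.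
Proof.
have /rdivp_unique U := monicXn K t.
have E : 'X^s = map_poly ev h * 'X^t + map_poly ev rho :> {poly K}.
  by rewrite -(stage_p0 St) -(stage_q0 St) -rmorphM -rmorphD -pE.
have sr : (size (map_poly ev rho) < size ('X^t : {poly K}))%N.
  by rewrite size_polyXn ltnS (leq_trans _ size_rho) // size_poly.
have [<- <-] := U _ _ _ E sr.
have E' : 'X^s = 'X^(s - t) * 'X^t + 0 :> {poly K} by rewrite addr0 -exprD subnK.
by apply: (U _ _ _ E'); rewrite size_poly0 size_polyXn.
Qed.

Lemma nth_y' i : y'`_i = if (i < size y)%N then y`_i else rho`_(i - size y).
Proof.
rewrite nth_cat; case: ltnP => // iy.
have [it|ti] := ltnP (i - size y) t.
  by rewrite (nth_map 0%N) ?size_iota // nth_iota // add0n.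
by rewrite !nth_default ?size_map ?size_iota // (leq_trans size_rho).
Qed.

Lemma ev_rho i : ev rho`_i = 0.
Proof. by have [_ /polyP/(_ i)] := ev_h_rho; rewrite coef_map coef0. Qed.

Lemma next_stage : stage y' h q (s - t) t a (a + b).
Proof.
have [hs0 _] := ev_h_rho.
have [a0 b0 deg dim] := And4 (stage_a St) (stage_b St) (stage_deg St) (stage_dim St).
split => //.
- exact: h_monic.
- exact: size_h.
- exact: stage_qs St.
- lia.
- by rewrite -deg -{2}(subnK ts) mulnDr mulnDl addnA.
- rewrite size_y'; lia.
- by move=> i; rewrite nth_y'; case: ifP => _; [exact: stage_y0 St i|exact: ev_rho].
- exact: stage_q0 St.
move=> eta pi kappa spi skap.
(* [sigma] gathers the derivatives prescribed for the coefficients of rho. By the product rule for p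
   = h q + rho, the derivative of p must then be [pi']. *)
pose sigma := \poly_(i < t) eta (size y + i)%N.
pose pi' := pi * q + h * kappa + sigma.
have spi' : (size pi' <= s)%N.
  apply: leq_trans (size_polyD _ _) _; rewrite geq_max; apply/andP; split; last first.
    by rewrite (leq_trans _ ts) // size_poly.
  apply: leq_trans (size_polyD _ _) _; rewrite geq_max; apply/andP; split.
    by apply: leq_trans (size_polyMleq _ _) _; rewrite (stage_qs St); lia.
  by apply: leq_trans (size_polyMleq _ _) _; rewrite size_h; lia.
have [w [wy wp wq]] := stage_coord St eta spi' skap.
have Dw := field_act_derivation w; have [DD DM] := dpoly_derivation Dw.
(* This is a division of 0 by the monic [q] with a remainder of degree less than t, so both
   differences vanish. *)
have E : (pi - dpoly (field_act w) h) * q + (sigma - dpoly (field_act w) rho) = 0.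
  have := wp; rewrite pE DD DM wq /pi' => /eqP; rewrite eq_sym -subr_eq0 => /eqP <-.
  ring.
have [] := rdivp_unique qm (esym E).
  rewrite (stage_qs St) ltnS (leq_trans (size_polyD _ _)) // geq_max size_poly /=.
  by rewrite size_polyN (leq_trans (size_dpoly Dw _)) // size_rho.
rewrite rdiv0p rmod0p => /esym/eqP; rewrite subr_eq0 => /eqP pih.
move=> /esym/eqP; rewrite subr_eq0 => /eqP sigr.
exists w; split => // i; rewrite size_y' nth_y' => iyt.
case: ltnP => iy; first exact: wy.
rewrite -(coef_dpoly Dw) -sigr coef_poly ltn_subLR // iyt.
by rewrite subnKC.
Qed.

Lemma size_G : (size (stage_poly p q a b) <= N)%N.
Proof. exact: size_stage_poly St. Qed.

Lemma size_G' : (size (stage_poly h q a (a + b)) <= N)%N.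
Proof. exact: size_stage_poly next_stage. Qed.

Lemma span_next_rho : coef_in (ideal_span G') rho.
Proof.
move=> i; have [it|ti] := ltnP i t; last first.
  by rewrite nth_default ?(leq_trans size_rho) //; case: (span_ideal G').
have := span_nth G' (size y + i)%N; rewrite gens_nth ?size_G' // size_y' ltn_add2l it.
by rewrite nth_y' ltnNge leq_addr /= addKn.
Qed.

Lemma span_next_y i : (i < size y)%N -> ideal_span G' y`_i.
Proof.
move=> iy; have := span_nth G' i; rewrite gens_nth ?size_G' // size_y' ltn_addr //.
by rewrite nth_y' iy.
Qed.

Lemma span_next_Q' : coef_in (ideal_span G') Q'.
Proof.
move=> i; have := span_nth G' (size y' + i)%N.
by rewrite gens_nth ?size_G' // ltnNge leq_addr /= addKn.
Qed.

Lemma span_Q : coef_in (ideal_span G) Q.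
Proof.
move=> i; have := span_nth G (size y + i)%N.
by rewrite gens_nth ?size_G // ltnNge leq_addr /= addKn.
Qed.

Lemma span_y i : (i < size y)%N -> ideal_span G y`_i.
Proof. by move=> iy; have := span_nth G i; rewrite gens_nth ?size_G // iy. Qed.

(** Since (h q)^a q^b = h^a q^(a+b), the difference is (p^a - (h q)^a) q^b, a multiple of p - h q =
    rho. *)
Lemma stage_poly_next (I : P -> Prop) : is_ideal (fun=> True) I -> coef_in I rho ->
  coef_in I (Q - Q').
Proof.
move=> HI Irho; have -> : Q - Q' = (p ^+ a - (h * q) ^+ a) * q ^+ b.
  by rewrite /Q /Q' /stage_poly exprMn exprD; ring.
rewrite subrXX; have -> : p - h * q = rho by rewrite [p in LHS]pE addrC addKr.
by rewrite -mulrA mulrC; apply: coef_inM.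
Qed.

Lemma span_next i : ideal_span G' G`_i.
Proof.
have [lt|ge] := ltnP i (size G); last first.
  by rewrite nth_default //; case: (span_ideal G').
rewrite gens_nth ?size_G //; case: ifP => iy; first exact: span_next_y.
have E := stage_poly_next (span_ideal G') span_next_rho (i - size y)%N.
rewrite coefB in E; apply/(ideal_cong I (span_ideal G') E); exact: span_next_Q'.
Qed.

Lemma ev_span_next f : ideal_span G' f -> ev f = 0.
Proof.
apply: (@span_min _ G' (fun g => ev g = 0)) => [|i _].
  split=> [|u v u0 v0|u v _ v0]; first exact: rmorph0.
    by rewrite rmorphD u0 v0 addr0.
  by rewrite rmorphM v0 mulr0.
rewrite gens_nth ?size_G' //; case: ifP => _; first exact: stage_y0 next_stage i.
rewrite -coef_map /= rmorphB rmorphM !rmorphXn /= map_polyX.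
rewrite (stage_p0 next_stage) (stage_q0 next_stage) -!exprM -exprD.
have -> : ((s - t) * a + t * (a + b))%N = N.
  by rewrite -(stage_deg next_stage); lia.
by rewrite subrr coef0.
Qed.

Let U := p ^+ a.-1 * q ^+ b.
Let Pm := p ^+ a.-1 * q ^+ b.-1.

Lemma monicU : U \is monic. Proof. by rewrite monicMl ?monic_exp. Qed.

Lemma monicPm : Pm \is monic. Proof. by rewrite monicMl ?monic_exp. Qed.

Lemma size_U : size U = (N - s).+1.
Proof.
rewrite size_monicXM // (stage_ps St) (stage_qs St) /= -(stage_deg St).
have := stage_a St; case: (a) => // a' _ /=; lia.
Qed.

Lemma size_Pm : size Pm = (N - s - t).+1.
Proof.
rewrite size_monicXM // (stage_ps St) (stage_qs St) /= -(stage_deg St).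
move: (stage_a St) (stage_b St); case: (a) => // a'; case: (b) => // b' _ _ /=.
lia.
Qed.

Lemma dpoly_stage_poly (D : P -> P) : derivation D ->
  dpoly D Q = U * (dpoly D p *+ a + h * dpoly D q *+ b) + Pm * rho * dpoly D q *+ b.
Proof.
move=> HD; have HDp := dpoly_derivation HD; have [_ DM] := HDp.
rewrite /Q /stage_poly (derB HDp) (dpolyXn HD) subr0 DM !(derX HDp) /U /Pm.
move: (stage_a St) (stage_b St); case: (a) => // a'; case: (b) => // b' _ _ /=.
rewrite !(exprS _ a') !(exprS _ b').
have -> : p * p ^+ a' = (h * q + rho) * p ^+ a' by rewrite -pE.
exact: leibniz_expand.
Qed.

(** Modulo rho only U (a dp + b h dq) remains of dQ, and a dp + b h dq has just s coefficients. The
    inner dimension size y + s equals N - t, which bounds the rank and kills the larger minors. *)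
Lemma jacobian_factor : exists (X : nat -> nat -> P) (Y : nat -> 'I_N -> P),
  forall i j, (i < size G)%N ->
  ideal_span G' (d j G`_i - \sum_(l < size y + s) X i l * Y l j).
Proof.
pose V j := dpoly (d j) p *+ a + h * dpoly (d j) q *+ b.
(* The left factor is the identity on the rows of [y] and, on the coefficients of [Q], the Toeplitz
   matrix of multiplication by [U]. The right factor holds the derivatives of [y] and the
   coefficients of [V j]. *)
exists (fun i l => if (i < size y)%N then (i == l)%:R else
  if ((size y <= l) && (l - size y <= i - size y))%N then U`_((i - size y) - (l - size y))
  else 0).
exists (fun l j => if (l < size y)%N then d j y`_l else (V j)`_(l - size y)).
move=> i j iG; rewrite gens_nth ?size_G //; case: ltnP => iy.
  rewrite (bigD1 (Ordinal (ltn_addr s iy))) //= eqxx mul1r iy big1 ?addr0 ?subrr.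
    by case: (span_ideal G').
  by move=> l li; rewrite [i == l]eq_sym (negPf (_ : val l != i)) ?mul0r.
rewrite big_split_ord /= [X in _ - (X + _)]big1 ?add0r => [|l _]; last first.
  by rewrite leqNgt ltn_ord /= mul0r.
rewrite -(coef_dpoly (Hd j)) dpoly_stage_poly // coefD.
set A := (U * _)`_ _; set B := (X in A + X).
have -> : \sum_(l < s) (if (size y <= size y + l)%N && (size y + l - size y <= i - size y)%N
      then U`_((i - size y) - (size y + l - size y)) else 0) *
    (if (size y + l < size y)%N then d j y`_(size y + l)
     else (V j)`_(size y + l - size y)) = A.
  rewrite /A -/(V j) mulrC coefM.
  have sV : (size (V j) <= s)%N.
    rewrite (leq_trans (size_polyD _ _)) // geq_max; apply/andP; split.
      rewrite (leq_trans (size_mulrn_leq _ _)) //.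
      by rewrite (leq_trans (size_dpoly_monic (Hd j) _)) // (stage_ps St).
    rewrite (leq_trans (size_mulrn_leq _ _)) // (leq_trans (size_polyMleq _ _)) //.
    have := size_dpoly_monic (Hd j) qm; rewrite (stage_qs St) size_h /= => dq.
    by rewrite -[leqRHS](subnK ts) leq_add2l.
  transitivity (\sum_(l < s | (l < (i - size y).+1)%N) (V j)`_l * U`_(i - size y - l)).
    rewrite [RHS]big_mkcond /=; apply: eq_bigr => l _.
    by rewrite addKn leq_addr ltnNge leq_addr /= ltnS; case: ifP; rewrite ?mul0r // mulrC.
  set m := (i - size y)%N; pose F l := (V j)`_l * U`_(m - l).
  (* The factorization sums over l < s and the convolution over l <= m; both are extended to a
     common range, [V j] having no coefficient from degree s on. *)
  rewrite (big_ord_widen_cond (s + m.+1) (fun l => l < m.+1)%N F) ?leq_addr //.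
  rewrite (big_ord_widen (s + m.+1) F) ?leq_addl // [RHS]big_mkcond [LHS]big_mkcond /=.
  apply: eq_bigr => l _; case: (ltnP l s) => ls; rewrite ?andbT ?andbF //.
  by rewrite /F nth_default ?mul0r ?if_same // (leq_trans sV).
rewrite addrC addKr.
by rewrite /B mulrAC -mulrnAl; apply: (coef_inM (span_ideal G')); apply: span_next_rho.
Qed.

(** Dividing by the monic [U] stays inside the ideal and yields elements whose derivatives isolate
    the two parts of dQ: [D1] the part divisible by [U], [R1] the part carrying rho. *)
Let D1 := rdivp Q U.
Let R1 := rmodp Q U.

Lemma size_R1 : (size R1 <= N - s)%N.
Proof. by rewrite -ltnS -size_U ltn_rmodpN0 // monic_neq0 // monicU. Qed.

Lemma span_D1_R1 : coef_in (ideal_span G) D1 /\ coef_in (ideal_span G) R1.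
Proof. have H := coef_in_div (span_ideal G) monicU span_Q. exact H. Qed.

(** Differentiate Q = D1 U + R1: the term D1 dU lies in the ideal, and uniqueness of division by [U]
    modulo the ideal separates the rest. A constant dq keeps Pm rho dq of degree below that of
    [U]. *)
Lemma act_cong (D : P -> P) : derivation D -> (size (dpoly D q) <= 1)%N ->
  ((0 < t)%N \/ dpoly D q = 0) ->
  coef_in (ideal_span G) (dpoly D D1 - (dpoly D p *+ a + h * dpoly D q *+ b)) /\
  coef_in (ideal_span G) (dpoly D R1 - Pm * rho * dpoly D q *+ b).
Proof.
move=> HD sq tq; have HDp := dpoly_derivation HD; have [DD DM] := HDp.
apply: (coef_in_cancel (span_ideal G) monicU).
  rewrite size_U ltnS (leq_trans (size_polyD _ _)) // geq_max size_polyN.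
  rewrite (leq_trans (size_dpoly HD _)) ?size_R1 //=.
  rewrite (leq_trans (size_mulrn_leq _ _)) //.
  case: tq => [t0|->]; last by rewrite mulr0 size_poly0.
  rewrite (leq_trans (size_polyMleq _ _)) //.
  have sPr : (size (Pm * rho)%R <= N - s)%N.
    rewrite (leq_trans (size_polyMleq _ _)) // size_Pm addSn /=.
    have tN : (t <= N - s)%N by have := stage_dim St; lia.
    by rewrite -[leqRHS](subnK tN) leq_add2l size_rho.
  by move: sPr sq; move: (size _) (size (dpoly D q)) => x z; lia.
have -> : (dpoly D D1 - (dpoly D p *+ a + h * dpoly D q *+ b)) * U +
    (dpoly D R1 - Pm * rho * dpoly D q *+ b) = - (dpoly D U * D1).
  have := dpoly_stage_poly HD; rewrite {1}(rdivp_eq monicU Q) DD DM -/D1 -/R1 => E.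
  have -> : dpoly D R1 = U * (dpoly D p *+ a + h * dpoly D q *+ b) +
      Pm * rho * dpoly D q *+ b - (dpoly D D1 * U + D1 * dpoly D U).
    by rewrite -E addrC addKr.
  ring.
by apply: (coef_inN (span_ideal G)); apply: (coef_inM (span_ideal G)); case: span_D1_R1.
Qed.

(** Rows of the Jacobian matrix to be triangularized: the [y], then s coefficients of [D1], and last
    the coefficient of [R1] selected by [i0]. Accordingly [pivot] lists the diagonal entries. *)
Definition family i0 i : P :=
  if (i < size y)%N then y`_i else
  if (i < size y + s)%N then D1`_(i - size y) else R1`_i0.

Definition pivot i0 i : P :=
  if (i < size y)%N then 1 else
  if (i < size y + s)%N then a%:R else (Pm * rho)`_i0 *+ b.

Lemma span_family i0 i : ideal_span G (family i0 i).
Proof.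
have [? ?] := span_D1_R1.
by rewrite /family; case: ifP => iy; [exact: span_y|case: ifP].
Qed.

(* The coordinate vector fields of [y], [p] and of the constant coefficient of
   [q] make the Jacobian matrix of [family] triangular modulo [gens]. *)
Lemma triangular_fields : exists w : nat -> 'I_N -> P, forall i0 i j,
  (i < size y + s + (0 < t))%N -> (j <= i)%N ->
  ideal_span G (field_act (w j) (family i0 i) - pivot i0 i *+ (i == j)).
Proof.
have /boolp.choice[w wP] : forall j, exists w : 'I_N -> P,
    [/\ forall i, (i < size y)%N -> field_act w y`_i = (i == j)%:R,
      dpoly (field_act w) p =
        'X^(j - size y) *+ ((size y <= j)%N && (j < size y + s)%N) &
      dpoly (field_act w) q = 1 *+ ((size y + s <= j)%N && (0 < t)%N)].
  move=> j; apply: (stage_coord St).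
    case: andP => [[yj js]|]; last by rewrite mulr0n size_poly0.
    by rewrite mulr1n size_polyXn ltn_subLR.
  by case: andP => [[_ t0]|]; rewrite ?mulr0n ?size_poly0 ?mulr1n ?size_poly1.
exists w => i0 i j; have [wy wp wq] := wP j; have Dw := field_act_derivation (w j).
have [I0 _ _] := span_ideal G.
have [] := act_cong Dw.
- by rewrite wq; case: (_ && _); rewrite ?mulr0n ?size_poly0 ?mulr1n ?size_poly1.
- by rewrite wq andbC; case: (0 < t)%N; [left|right].
move=> cD cR it ji; rewrite /family /pivot; case: ltnP => iy.
  by rewrite wy // subrr.
case: ltnP => iys.
  have := cD (i - size y)%N; rewrite coefB (coef_dpoly Dw) wp wq.
  rewrite [(size y + s <= j)%N]leqNgt (leq_ltn_trans ji iys) /= mulr0 mul0rn addr0.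
  rewrite andbT coefMn; case: leqP => yj /=; last first.
    by rewrite mulr0n coef0 mul0rn gtn_eqF ?mulr0n // (leq_trans yj).
  rewrite mulr1n coefXn; congr (ideal_span _ (_ - _)).
  have -> : (i - size y == j - size y)%N = (i == j) by apply/eqP/eqP; lia.
  by case: (i == j); rewrite ?mul0rn.
have t0 : (0 < t)%N by move: it; case: (0 < t)%N => //; rewrite addn0 ltnNge iys.
have ie : i = (size y + s)%N by move: it; rewrite t0; lia.
have := cR i0; rewrite coefB (coef_dpoly Dw) wq t0 andbT -ie coefMn.
have -> : (i <= j)%N = (i == j) by rewrite eqn_leq ji andbT.
by case: (i == j); rewrite ?mulr1 ?mulr0 ?coef0 ?mul0rn ?mulr0n.
Qed.

Lemma det_fields k (w : nat -> 'I_N -> P) (F : 'I_k -> P) :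
  \matrix_(i < k, j < k) field_act (w j) (F i) =
  (\matrix_(i < k, j < N) d j (F i)) *m (\matrix_(j < N, i < k) w i j).
Proof. by apply/matrixP => i j; rewrite !mxE; apply: eq_bigr => l _; rewrite !mxE mulrC. Qed.

(** The triangular determinant puts a^s b times each coefficient of Pm rho into [Z]; the integer is
    invertible, and the monic [Pm] cancels, leaving rho. Leaving [Z] arbitrary allows combinations
    with polynomial coefficients later. *)
Lemma span_next_minors (Z : P -> Prop) : is_ideal (fun=> True) Z ->
  (forall f, ideal_span G f -> Z f) ->
  (forall (F : 'I_(N - t + 1) -> P) (cols : 'I_(N - t + 1) -> 'I_N),
    (forall i, ideal_span G (F i)) -> {homo cols : i j / (i < j)%N} ->
    Z (\det (\matrix_(i, j) d (cols j) (F i)))) ->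
  forall f, ideal_span G' f -> Z f.
Proof.
move=> HZ ZG Zminor.
(* For t = 0 one has q = 1, rho = 0 and h = p, so the step changes nothing. *)
have [t0|t0] := posnP t.
  have q1 : q = 1.
    have [c qc] : exists c, q = c%:P.
      by exists q`_0; apply: size1_polyC; rewrite (stage_qs St) t0.
    by have := monicP qm; rewrite qc lead_coefC => ->.
  have rho0 : rho = 0 by rewrite /rho q1 rmodp1.
  have hp : h = p by rewrite [p in RHS]pE rho0 q1 mulr1 addr0.
  apply: span_min => // i _; have := ZG _ (span_nth G i).
  by rewrite /G /G' hp /gens /stage_poly /y' /next_y t0 q1 !expr1n cats0.
have ZPm i0 : Z (Pm * rho)`_i0.
  have [w wP] := triangular_fields.
  pose k := (N - t + 1)%N; pose F (i : 'I_k) := family i0 i.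
  have kE : k = (size y + s).+1 by rewrite /k -(stage_dim St); lia.
  have Zdet : Z (\det (\matrix_(i, j) field_act (w j) (F i))).
    rewrite det_fields; apply: (minors_mulmx _ _ _ HZ) => // f fP.
    have := Zminor F f (fun i => span_family i0 i) fP.
    by congr (Z (\det _)); apply/matrixP => i j; rewrite !mxE.
  have Ztri : Z (\det (\matrix_(i, j) field_act (w j) (F i)) - \prod_(i < k) pivot i0 i).
    apply: det_triangular_cong => // i j ji; rewrite mxE; apply: ZG; apply: wP => //.
    by rewrite t0 addn1 -kE.
  have {Ztri} := (ideal_cong I HZ Ztri).1 Zdet.
  have -> : \prod_(i < k) pivot i0 i = (a ^ s * b)%:R * (Pm * rho)`_i0.
    rewrite kE big_ord_recr big_split_ord /= /pivot ltnNge leq_addr ltnn /=.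
    rewrite big1 => [|i _]; last by rewrite ltn_ord.
    under eq_bigr do rewrite ltnNge leq_addr /= ltn_add2l ltn_ord.
    by rewrite prodr_const card_ord mul1r natrM natrX -mulrA mulr_natl.
  have [u uE] : exists u : P, u * (a ^ s * b)%:R = 1.
    by apply: natV; rewrite muln_gt0 expn_gt0 (stage_a St) (stage_b St).
  by case: HZ => _ _ ZM /(ZM u _ I); rewrite mulrA uE mul1r.
(* Pm rho is read as a division by [Pm] with quotient rho and remainder 0. *)
have [Zrho _] : coef_in Z rho /\ coef_in Z (0 : {poly P}).
  apply: (coef_in_cancel HZ monicPm); first by rewrite size_poly0 size_Pm.
  by rewrite addr0 mulrC.
have ZQ i : Z Q'`_i.
  have := stage_poly_next HZ Zrho i; rewrite coefB => E.
  by apply/(ideal_cong I HZ E)/ZG/span_Q.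
apply: span_min => // i _; rewrite gens_nth ?size_G' // nth_y'.
case: ifP => _; last exact: ZQ.
by case: ltnP => iy; [apply/ZG/span_y|apply: Zrho].
Qed.

Lemma ev_span f : ideal_span G f -> ev f = 0.
Proof.
case=> c ->; rewrite rmorph_sum big1 // => i _.
by rewrite rmorphM (ev_span_next (span_next i)) mulr0.
Qed.

(** The rows of [y] and [D1] number size y + s = N - t. At the base point the congruences become
    equalities, and the determinant along the coordinate fields is a product of factors 1 and a,
    nonzero in [K]. *)
Lemma jacobian_row_free : exists F : 'I_(N - t) -> P, (forall i, ideal_span G (F i)) /\
  row_free (\matrix_(i, j) ev (d j (F i))).
Proof.
have [w wP] := triangular_fields.
pose F (i : 'I_(N - t)) := family 0%N i; exists F; split; first exact: span_family.
set A := \matrix_(i, j) _.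
pose W := \matrix_(j < N, i < N - t) ev (w i j).
suff detAW : \det (A *m W) != 0.
  rewrite -row_leq_rank -[X in (X <= _)%N](mxrank_unit (_ : A *m W \in unitmx)).
    exact: mxrankM_maxl.
  by rewrite unitmxE unitfE.
have kE : (N - t = size y + s)%N by have := stage_dim St; lia.
have : \det (A *m W) - \prod_(i < N - t) (if (i < size y)%N then 1 else a%:R) = 0.
  apply: (@det_triangular_cong _ (fun x => x = 0)) => [|i j ji].
    by split => // [x z -> ->|c x _ ->]; rewrite ?addr0 ?mulr0.
  have ie : (i < size y + s)%N by rewrite -kE.
  have := ev_span (wP 0%N i j _ ji); rewrite rmorphB rmorphMn /=.
  rewrite /pivot ie (fun_if ev) rmorph1 rmorph_nat => <-; last by rewrite ltn_addr.
  congr (_ - _); rewrite /field_act rmorph_sum mxE; apply: eq_bigr => l _.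
  by rewrite !mxE rmorphM mulrC.
move/eqP; rewrite subr_eq0 => /eqP ->.
apply/prodf_neq0 => i _; case: ifP => _; rewrite ?oner_neq0 // pnatr_eq0 -lt0n.
exact: stage_a St.
Qed.

End Step.

Definition at_stage (G : seq P) s t := (t <= s)%N /\
  exists y p q a b, stage y p q s t a b /\ G = gens y p q a b.

Lemma at_stage_sort y p q s t a b : stage y p q s t a b ->
  at_stage (gens y p q a b) (maxn s t) (minn s t).
Proof.
move=> St; split; first by rewrite geq_min leq_max leqnn.
case: (leqP s t) => st.
  exists y, q, p, b, a; split; first exact: stageC.
  by rewrite /gens stage_polyC.
by exists y, p, q, a, b.
Qed.

Lemma at_stage_le G s t : at_stage G s t -> (t <= N)%N.
Proof.
by case=> _ [y [p [q [a [b [/stage_dim <- _]]]]]]; rewrite leq_addl.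
Qed.

Lemma at_stage_row_free G s t : at_stage G s t ->
  exists F : 'I_(N - t) -> P, (forall i, ideal_span G (F i)) /\
    row_free (\matrix_(i, j) ev (d j (F i))).
Proof.
case=> ts [y [p [q [a [b [St ->]]]]]]; exact: jacobian_row_free St ts.
Qed.

(** What the analytic side needs from a step: the sorted next stage, inclusion and vanishing at the
    base point, the factorization (upper bound) and the minors (lower bound). *)
Lemma at_stage_next G s t : at_stage G s t -> exists G', [/\
  at_stage G' (maxn (s - t) t) (minn (s - t) t),
  (forall i, ideal_span G' G`_i) /\ (forall f, ideal_span G' f -> ev f = 0),
  (exists (X : nat -> nat -> P) (Y : nat -> 'I_N -> P), forall i j, (i < size G)%N ->
    ideal_span G' (d j G`_i - \sum_(l < N - t) X i l * Y l j)) &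
  forall Z : P -> Prop, is_ideal (fun=> True) Z -> (forall f, ideal_span G f -> Z f) ->
    (forall (F : 'I_(N - t + 1) -> P) (cols : 'I_(N - t + 1) -> 'I_N),
      (forall i, ideal_span G (F i)) -> {homo cols : i j / (i < j)%N} ->
      Z (\det (\matrix_(i, j) d (cols j) (F i)))) ->
    forall f, ideal_span G' f -> Z f].
Proof.
case=> ts [y [p [q [a [b [St ->]]]]]].
exists (gens (next_y y p q t) (rdivp p q) q a (a + b)); split.
- exact: at_stage_sort (next_stage St ts).
- by split; [exact: span_next St ts|exact: ev_span_next St ts].
- have -> : (N - t = size y + s)%N by have := stage_dim St; lia.
  exact: jacobian_factor St ts.
- exact: span_next_minors St ts.
Qed.

End Stages.

(** * Differentiation of power series *)

Section PowerEstimates.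
Variable K : numFieldType.
Implicit Types x t s : K.

(** The b-th derivative of x^m; for b > m the truncated exponent is harmless, as the falling
    factorial is 0. *)
Definition dpow m b x : K := x ^+ (m - b) *+ m ^_ b.

Lemma dpow0 m x : dpow m 0 x = x ^+ m.
Proof. by rewrite /dpow subn0 ffactn0. Qed.

Lemma norm_dpow m b x : `|dpow m b x| = dpow m b `|x|.
Proof. by rewrite /dpow normrMn normrX. Qed.

Lemma dpow_le m b x y : 0 <= x -> x <= y -> dpow m b x <= dpow m b y.
Proof. by move=> x0 xy; rewrite /dpow lerMn2r lerXn2r ?orbT // nnegrE (le_trans x0). Qed.

(* [C(m, b) x^(m-b) s^b] is one of the terms of the expansion of [(x + s)^m]. *)
Lemma dpow_bound m b x s : 0 <= x -> 0 < s ->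
  dpow m b x <= (x + s) ^+ m * (b`!%:R * s ^- b).
Proof.
move=> x0 s0; have xs0 : 0 <= x + s by rewrite addr_ge0 // ltW.
have [mb|bm] := ltnP m b.
  rewrite /dpow ffact_small // mulr0n mulr_ge0 ?exprn_ge0 //.
  by rewrite mulr_ge0 ?ler0n // invr_ge0 exprn_ge0 // ltW.
rewrite mulrA ler_pdivlMr ?exprn_gt0 //.
have -> : dpow m b x * s ^+ b = (x ^+ (m - b) * s ^+ b *+ 'C(m, b)) * b`!%:R.
  by rewrite /dpow -bin_ffact mulrnA mulr_natr !mulrnAl.
rewrite ler_wpM2r ?ler0n //.
rewrite exprDn (bigD1 (inord b : 'I_m.+1)) //= inordK ?ltnS //.
rewrite ler_wpDr // sumr_ge0 // => i _.
by rewrite mulrn_wge0 // mulr_ge0 ?exprn_ge0 // ltW.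
Qed.

(** A power of |x| + s replaces the usual factor n, so that after summation the bound is a series of
    the same coefficients at a larger radius. The second-order estimate follows the same
    induction. *)
Lemma expr_diff1 n x t s : 0 < s -> `|t| <= s ->
  `|(x + t) ^+ n - x ^+ n| <= `|t| / s * (`|x| + s) ^+ n.
Proof.
move=> s0 ts; elim: n => [|n IH].
  by rewrite !expr0 subrr normr0 mulr1 divr_ge0 // ltW.
have -> : (x + t) ^+ n.+1 - x ^+ n.+1 = x * ((x + t) ^+ n - x ^+ n) + t * (x + t) ^+ n.
  by rewrite !exprS; ring.
have -> : `|t| / s * (`|x| + s) ^+ n.+1 =
    `|x| * (`|t| / s * (`|x| + s) ^+ n) + `|t| * (`|x| + s) ^+ n.
  by rewrite exprS; field; rewrite gt_eqF.
rewrite (le_trans (ler_normD _ _)) // !normrM lerD ?ler_wpM2l //.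
by rewrite normrX lerXn2r ?nnegrE ?addr_ge0 ?(ltW s0) // (le_trans (ler_normD _ _)) ?lerD.
Qed.

Lemma expr_diff2 n x t s : 0 < s -> `|t| <= s ->
  `|(x + t) ^+ n - x ^+ n - t * (x ^+ n.-1 *+ n)| <= (`|t| / s) ^+ 2 * (`|x| + s) ^+ n.
Proof.
move=> s0 ts; elim: n => [|n IH].
  by rewrite !expr0 mulr0n mulr0 subr0 subrr normr0 mulr1 exprn_ge0 // divr_ge0 // ltW.
have -> : (x + t) ^+ n.+1 - x ^+ n.+1 - t * (x ^+ n.+1.-1 *+ n.+1) =
    x * ((x + t) ^+ n - x ^+ n - t * (x ^+ n.-1 *+ n)) + t * ((x + t) ^+ n - x ^+ n).
  case: n {IH} => [|n]; first by rewrite !expr0 !expr1 mulr0n mulr1n; ring.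
  rewrite /= -(mulr_natl (x ^+ n.+1)) -(mulr_natl (x ^+ n)) !exprS.
  by rewrite -(natr1 n.+1); ring.
have -> : (`|t| / s) ^+ 2 * (`|x| + s) ^+ n.+1 =
    `|x| * ((`|t| / s) ^+ 2 * (`|x| + s) ^+ n) + `|t| * (`|t| / s * (`|x| + s) ^+ n).
  by rewrite (exprS (_ + _)); field; rewrite gt_eqF.
by rewrite (le_trans (ler_normD _ _)) // !normrM lerD ?ler_wpM2l ?expr_diff1.
Qed.

Lemma dpow_diff m b x t s : 0 < s -> `|t| <= s ->
  `|dpow m b (x + t) - dpow m b x - t * dpow m b.+1 x| <=
    (`|t| / s) ^+ 2 * dpow m b (`|x| + s).
Proof.
move=> s0 ts; rewrite /dpow ffactnSr subnS mulnC mulrnA.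
rewrite [t * _]mulrnAr -!mulrnBl normrMn [leRHS]mulrnAr lerMn2r.
by rewrite expr_diff2 ?orbT.
Qed.

End PowerEstimates.

(** * Bounds for derivatives of monomials in several variables *)

Section MonomialEstimates.
Variables (R : realType) (N : nat).
Local Notation C := (Cfield R).
Local Notation V := 'rV[C]_N.
Local Notation idx := {ffun 'I_N -> nat}.
Implicit Types (al be : idx) (w : V).

(* The partial derivative of multi-order [be] of the monomial [al]. *)
Definition dmonomial be al w : C := \prod_i dpow (al i) (be i) (w 0 i).

Definition incr be (j : 'I_N) : idx := [ffun i => be i + (i == j)]%N.

Lemma dmonomial0 al w : dmonomial [ffun=> 0%N] al w = monomial al w.
Proof. by apply: eq_bigr => i _; rewrite ffunE dpow0. Qed.

(** The loss in [dpow_bound] taken over all variables; it is the same for every monomial. *)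
Definition dconst be (s : C) : C := \prod_i ((be i)`!%:R * s ^- be i).

Lemma dmonomial_bound be al w (s : C) : 0 < s -> (forall i, `|w 0 i| <= s) ->
  `|dmonomial be al w| <= monomial al (const_mx (s + s)) * dconst be s.
Proof.
move=> s0 ws; rewrite normr_prod /monomial /dconst -big_split /=.
apply: ler_prod => i _; rewrite normr_ge0 /= mxE norm_dpow.
apply: (le_trans (dpow_le _ _ (normr_ge0 _) (ws i))).
by apply: dpow_bound => //; apply: ltW.
Qed.

(** Only the j-th factor moves, so the one-variable remainder applies to it. The radius 4s arises
    because |w_j| + s <= 2s and [dpow_bound] with increment 2s doubles this. *)
Lemma dmonomial_diff be al w j (t s : C) : 0 < s ->
  (forall i, `|w 0 i| <= s) -> `|t| <= s ->
  `|dmonomial be al (w + t *: delta_mx 0 j) - dmonomial be al w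
     - t * dmonomial (incr be j) al w| <=
  (`|t| / s) ^+ 2 * (monomial al (const_mx (s + s + (s + s))) * dconst be (s + s)).
Proof.
move=> s0 ws ts; rewrite /dmonomial (bigD1 j) //= [X in _ - X - _](bigD1 j) //=.
rewrite [X in _ - t * X](bigD1 j) //= !mxE !eqxx mulr1 ffunE eqxx addn1.
set A := \prod_(i | i != j) dpow (al i) (be i) (w 0 i).
rewrite [X in _ * X - _ - _](_ : _ = A); last first.
  by apply: eq_bigr => i ij; rewrite !mxE (negPf ij) andbF mulr0 addr0.
rewrite [X in _ - t * (_ * X)](_ : _ = A); last first.
  by apply: eq_bigr => i ij; rewrite ffunE (negPf ij) addn0.
rewrite mulrA -!mulrBl normrM /monomial /dconst -big_split /= (bigD1 j) //= mulrA.
have ss0 : 0 < s + s by rewrite addr_gt0.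
apply: ler_pM => //.
  apply: (le_trans (dpow_diff _ _ _ s0 ts)); rewrite ler_wpM2l ?exprn_ge0 ?divr_ge0 ?(ltW s0) //.
  rewrite mxE; apply: le_trans (dpow_bound _ _ (ltW ss0) ss0).
  by apply: dpow_le; rewrite ?addr_ge0 ?(ltW s0) // lerD.
rewrite normr_prod; apply: ler_prod => i _; rewrite normr_ge0 /= mxE norm_dpow.
apply: le_trans (dpow_bound _ _ (ltW ss0) ss0).
by apply: dpow_le => //; rewrite (le_trans (ws i)) // lerDl ltW.
Qed.

End MonomialEstimates.

(** * Convergence of box sums of complex series *)

Section ComplexSeries.
Variables (R : realType) (N : nat).
Local Notation C := (Cfield R).
Local Notation V := 'rV[C]_N.
Local Notation idx := {ffun 'I_N -> nat}.
Implicit Types (t u : idx -> C).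

Lemma normC_Re_le (z : C) : `|'Re z| <= `|z|.
Proof.
rewrite real_ler_norml ?Creal_Re // leif_Re_Creal andbT lerNl -raddfN /= -normrN.
exact: leif_Re_Creal.
Qed.

Lemma normC_Im_le (z : C) : `|'Im z| <= `|z|.
Proof.
have := normC_Re_le ('i * z); rewrite ReMil normrN normrM normCi mul1r; exact.
Qed.

Lemma box_sumD t u k : box_sum (fun al => t al + u al) k = box_sum t k + box_sum u k.
Proof. exact: big_split. Qed.

Lemma box_sumZ (c : C) t k : box_sum (fun al => c * t al) k = c * box_sum t k.
Proof. by rewrite /box_sum mulr_sumr. Qed.

Lemma box_sumB t u k : box_sum (fun al => t al - u al) k = box_sum t k - box_sum u k.
Proof. by rewrite /box_sum -sumrB. Qed.

Lemma box_sum_le t u k : (forall al, t al <= u al) -> box_sum t k <= box_sum u k.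
Proof. by move=> tu; apply: ler_sum. Qed.

Lemma norm_box_sum t k : `|box_sum t k| <= box_sum (fun al => `|t al|) k.
Proof. exact: ler_norm_sum. Qed.

Lemma box_sum_homo t k l : (forall al, 0 <= t al) -> (k <= l)%N ->
  box_sum t k <= box_sum t l.
Proof.
move=> t0 kl; pose e (al : {ffun 'I_N -> 'I_k}) := [ffun i => widen_ord kl (al i)].
have e_inj : injective e.
  move=> al be /ffunP E; apply/ffunP => i; have := E i; rewrite !ffunE.
  by move/(congr1 val) => /= /val_inj.
pose T (al : {ffun 'I_N -> 'I_l}) := t [ffun i => al i : nat].
have -> : box_sum t k = \sum_(al in e @: {: {ffun 'I_N -> 'I_k}}) T al.
  rewrite big_imset /=; last by move=> ? ? _ _; apply: e_inj.
  apply: eq_big => // al _; rewrite /T; congr (t _).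
  by apply/ffunP => i; rewrite !ffunE.
rewrite /box_sum [leRHS](bigID (mem (e @: {: {ffun 'I_N -> 'I_k}}))) /=.
by rewrite lerDl sumr_ge0 // => al _; apply: t0.
Qed.

Lemma cvg_real_complex (u : R^nat) (l : R) : u k @[k --> \oo] --> l ->
  ((u k)%:C%C : C) @[k --> \oo] --> (l%:C%C : C).
Proof.
move=> /cvgrPdist_lt ul; apply/cvgrPdist_lt => e e0.
have eE : e = ((complex.Re e)%:C)%C by rewrite RRe_real // gtr0_real.
have Re0 : 0 < complex.Re e by move: e0; rewrite eE ltcR.
near=> k; rewrite -[_ - _](rmorphB (real_complex R)) /= normc_def /=.
rewrite expr0n addr0 sqrtr_sqr eE ltcR.
by near: k; apply: ul.
Unshelve. all: by end_near. Qed.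

Lemma nonneg_series_cvg t (M : C) : (forall al, 0 <= t al) ->
  (forall k, box_sum t k <= M) -> exists l : C, box_sum t k @[k --> \oo] --> l.
Proof.
move=> t0 tM.
have bs0 k : 0 <= box_sum t k by apply: sumr_ge0.
have bsE k : box_sum t k = ((complex.Re (box_sum t k))%:C)%C.
  by rewrite RRe_real // ger0_real.
have nd : nondecreasing_seq (fun k => complex.Re (box_sum t k)).
  by move=> k l kl; have := box_sum_homo t0 kl; rewrite lecE => /andP[].
have ub : has_ubound (range (fun k => complex.Re (box_sum t k))).
  by exists (complex.Re M) => _ [k _ <-]; have := tM k; rewrite lecE => /andP[].
have /cvg_real_complex := nondecreasing_cvgn nd ub; set l := sup _ => H.
exists (l%:C)%C; rewrite (_ : box_sum t = fun k => ((complex.Re (box_sum t k))%:C%C : C)) //.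
by apply/funext.
Qed.

(** Real and imaginary parts are treated separately: a real u with |u| <= |t| is |t| - (|t| - u), a
    difference of nonnegative terms with box sums bounded by [M] and 2M. *)
Lemma abs_series_is_cvg t (M : C) : (forall k, box_sum (fun al => `|t al|) k <= M) ->
  exists l : C, box_sum t k @[k --> \oo] --> l.
Proof.
move=> tM.
have nneg (u : idx -> C) : (forall al, u al \is Num.real) ->
    (forall al, `|u al| <= `|t al|) -> exists l : C, box_sum u k @[k --> \oo] --> l.
  move=> ur ut; have [|l1 H1] := @nonneg_series_cvg (fun al => `|t al|) M _ tM.
    by move=> al; apply: normr_ge0.
  have [||l2 H2] := @nonneg_series_cvg (fun al => `|t al| - u al) (M + M).
  - by move=> al; rewrite subr_ge0 (le_trans _ (ut al)) // real_ler_norm.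
  - move=> k; rewrite box_sumB lerD // -[leLHS]mulN1r -box_sumZ.
    apply: le_trans (tM k).
    apply: box_sum_le => al; rewrite mulN1r (le_trans _ (ut al)) //.
    by rewrite -[leRHS]normrN real_ler_norm // rpredN.
  exists (l1 - l2); rewrite (_ : box_sum u = fun k =>
    box_sum (fun al => `|t al|) k - box_sum (fun al => `|t al| - u al) k).
    exact: cvgB H1 H2.
  by apply/funext => k; rewrite box_sumB opprB addrC subrK.
have [||l1 H1] := nneg (fun al => 'Re (t al)).
- by move=> al; apply: Creal_Re.
- by move=> al; apply: normC_Re_le.
have [||l2 H2] := nneg (fun al => 'Im (t al)).
- by move=> al; apply: Creal_Im.
- by move=> al; apply: normC_Im_le.
exists (l1 + 'i * l2); rewrite (_ : box_sum t = fun k =>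
    box_sum (fun al => 'Re (t al)) k + 'i * box_sum (fun al => 'Im (t al)) k).
  exact: (cvgD H1 (cvgM (cvg_cst ('i : C)) H2)).
by apply/funext => k; rewrite -box_sumZ -box_sumD; apply: eq_bigr => al _; rewrite -Crect.
Qed.

Lemma norm_limit_le (u : nat -> C) (l B : C) : u k @[k --> \oo] --> l ->
  (forall k, `|u k| <= B) -> `|l| <= B.
Proof.
move=> ul uB; apply/ler_addgt0Pr => e e0.
have /cvgrPdist_lt/(_ e e0) [k _ /(_ k (leqnn k)) /= H] := ul.
rewrite -(subrK (u k) l) addrC (le_trans (ler_normD _ _)) // lerD // ltW //.
Qed.

End ComplexSeries.

(** * Termwise differentiation *)

Section PowerSeries.
Variables (R : realType) (N : nat).
Local Notation C := (Cfield R).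
Local Notation V := 'rV[C]_N.
Local Notation idx := {ffun 'I_N -> nat}.
Local Notation partial j f := (fun z : V => 'D_(delta_mx 0 j) (f : V -> C^o) z : C).

Lemma norm_coord_le (w : V) i : `|w 0 i| <= `|w|.
Proof.
rewrite [leRHS]mx_normE -[leLHS]nngE num_le.
exact: (le_bigmax _ (fun x : 'I_1 * 'I_N => `|w x.1 x.2|%:nng%R) (0, i)).
Qed.

Lemma cvg_line (w v : V) : w + t *: v @[t --> (0 : C)] --> w.
Proof.
have h1 : (fun t : C => w) @ (0 : C) --> w by exact: (@cvg_cst V w C (nbhs (0 : C)) _).
have h2 : (fun t : C => t *: v) @ (0 : C) --> (0 : C) *: v by exact: scalel_continuous.
have h12 := cvgD h1 h2; rewrite scale0r addr0 in h12; exact: h12.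
Qed.

Lemma monomial_ge0 (al : idx) (s : C) : 0 <= s -> 0 <= monomial al (const_mx s : V).
Proof. by move=> s0; apply: prodr_ge0 => i _; rewrite mxE exprn_ge0. Qed.

Lemma monomial_le (al : idx) (s s' : C) : 0 <= s -> s <= s' ->
  monomial al (const_mx s : V) <= monomial al (const_mx s').
Proof.
move=> s0 ss; apply: ler_prod => i _; rewrite !mxE exprn_ge0 //= lerXn2r //.
by rewrite nnegrE (le_trans s0).
Qed.

(* [f] is, near the origin, the termwise [be]-th derivative of the power series
   with coefficients [a]. *)
Definition termwise (a : idx -> C) (be : idx) (f : V -> C) : Prop :=
  (exists s M : C, 0 < s /\
    forall k, box_sum (fun al => `|a al| * monomial al (const_mx s : V)) k <= M) /\
  \forall w \near (0 : V), box_sum (fun al => a al * dmonomial be al w) k @[k --> \oo] --> f w.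

Lemma power_series_termwise f : power_series_at f (0 : V) ->
  exists a, termwise a [ffun=> 0%N] f.
Proof.
case=> a Ha; exists a; split; last first.
  apply: filterS Ha => w [_]; rewrite subr0.
  by under eq_fun do under [box_sum _ _]eq_bigr do rewrite -dmonomial0.
(* Absolute convergence at diagonal points (t, ..., t) near 0 bounds the series at a common radius;
   half the radius of a ball of such t is used below. *)
have : \forall t \near (0 : C), exists M : C, forall k,
    box_sum (fun al => `|a al * monomial al (t *: const_mx 1 : V)|) k <= M.
  have : \forall t \near (0 : C),
      abs_series_cvg (fun al => a al * monomial al (0 + t *: const_mx 1 - 0 : V))
        (f (0 + t *: const_mx 1)).
    exact: (@cvg_line 0 (const_mx 1 : V) _ Ha).
  by apply: filterS => t [[M HM] _]; exists M; move: HM; rewrite add0r subr0.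
move=> /nbhs_ballP[r /= r0 H].
have r20 : 0 < r / 2%:R by rewrite divr_gt0 // ltr0n.
have [|M HM] := H (r / 2%:R).
  rewrite -ball_normE /= sub0r normrN gtr0_norm // ltr_pdivrMr ?ltr0n //.
  by rewrite mulr_natr mulr2n ltrDl.
exists (r / 2%:R), M; split=> // k; apply: le_trans (HM k); apply: box_sum_le => al.
have -> : (r / 2%:R) *: const_mx 1 = const_mx (r / 2%:R) :> V.
  by apply/rowP => i; rewrite !mxE mulr1.
by rewrite normrM [`|monomial _ _|]ger0_norm // monomial_ge0 // ltW.
Qed.

(** The second-order remainder of each monomial is summed over boxes and passed to the limit, so the
    difference quotient is within a constant times |t| of the termwise derivative. Coefficients and
    radius are unchanged, which permits iteration. *)
Lemma termwise_derive a be f j : termwise a be f ->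
  (\forall w \near (0 : V), derivable (f : V -> C^o) w (delta_mx 0 j)) /\
  termwise a (incr be j) (partial j f).
Proof.
move=> [[s [M [s0 sM]]] fw].
(* [dmonomial_diff] evaluates monomials at four times the bound on w, hence exactly at the radius s
   where the sums are bounded. *)
pose s4 := s / 4%:R.
have s40 : 0 < s4 by rewrite divr_gt0 // ltr0n.
have sE : s4 + s4 + (s4 + s4) = s by rewrite /s4; field.
suff H : \forall w \near (0 : V), exists l : C,
    (box_sum (fun al => a al * dmonomial (incr be j) al w) k @[k --> \oo] --> l) /\
    is_derive w (delta_mx 0 j) (f : V -> C^o) l.
  split; first by apply: filterS H => w [l [_ [? _]]].
  split; first by exists s, M.
  by apply: filterS H => w [l [cl [_ ->]]].
have near_s4 : \forall w \near (0 : V), `|w| < s4 by apply: nbhs0_lt.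
near=> w.
have ws i : `|w 0 i| <= s4.
  by rewrite (le_trans (norm_coord_le w i)) // ltW //; near: w.
have cw : \forall w' \near w,
    box_sum (fun al => a al * dmonomial be al w') k @[k --> \oo] --> f w'.
  by near: w; apply: (near_join fw).
have M0 : 0 <= M.
  apply: le_trans (sM 0%N); apply: sumr_ge0 => al _.
  by rewrite mulr_ge0 // monomial_ge0 // ltW.
have [l cl] : exists l : C,
    box_sum (fun al => a al * dmonomial (incr be j) al w) k @[k --> \oo] --> l.
  apply: (@abs_series_is_cvg _ _ _ (M * dconst (incr be j) s4)) => k.
  rewrite mulrC; apply: (le_trans _ (ler_wpM2l _ (sM k))); last first.
    by apply: prodr_ge0 => i _; rewrite mulr_ge0 ?ler0n // invr_ge0 exprn_ge0 // ltW.
  rewrite -box_sumZ; apply: box_sum_le => al; rewrite normrM mulrCA ler_wpM2l //.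
  rewrite (le_trans (dmonomial_bound _ _ s40 ws)) // mulrC ler_wpM2l //.
    by apply: prodr_ge0 => i _; rewrite mulr_ge0 ?ler0n // invr_ge0 exprn_ge0 // ltW.
  by rewrite monomial_le ?addr_ge0 ?(ltW s40) // -sE lerDl addr_ge0 // ltW.
exists l; split; first exact: cl.
pose B := dconst be (s4 + s4) * M / s4 ^+ 2.
have dc0 : 0 <= dconst be (s4 + s4).
  apply: prodr_ge0 => i _; rewrite mulr_ge0 ?ler0n // invr_ge0 exprn_ge0 //.
  by rewrite addr_ge0 // ltW.
have B0 : 0 <= B by apply: divr_ge0; [exact: mulr_ge0|exact/exprn_ge0/ltW].
have bound (t : C) : `|t| <= s4 ->
    box_sum (fun al => a al * dmonomial be al (w + t *: delta_mx 0 j)) k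
      @[k --> \oo] --> f (w + t *: delta_mx 0 j) ->
    `|f (w + t *: delta_mx 0 j) - f w - t * l| <= `|t| ^+ 2 * B.
  move=> ts ct.
  apply: (@norm_limit_le _ (fun k =>
    box_sum (fun al => a al * dmonomial be al (w + t *: delta_mx 0 j)) k -
    box_sum (fun al => a al * dmonomial be al w) k -
    t * box_sum (fun al => a al * dmonomial (incr be j) al w) k)) => [|k].
    exact: (cvgB (cvgB ct (nbhs_singleton cw)) (cvgM (cvg_cst (t : C)) cl)).
  rewrite -box_sumZ -!box_sumB.
  rewrite (le_trans (norm_box_sum _ _)) //.
  have -> : `|t| ^+ 2 * B = (`|t| / s4) ^+ 2 * dconst be (s4 + s4) * M.
    by rewrite /B; field; rewrite gt_eqF.
  apply: (le_trans _ (ler_wpM2l _ (sM k))); last first.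
    by rewrite mulr_ge0 // exprn_ge0 // divr_ge0 // ltW.
  rewrite -box_sumZ; apply: box_sum_le => al.
  have -> : a al * dmonomial be al (w + t *: delta_mx 0 j) - a al * dmonomial be al w -
     t * (a al * dmonomial (incr be j) al w) =
     a al * (dmonomial be al (w + t *: delta_mx 0 j) - dmonomial be al w
       - t * dmonomial (incr be j) al w) by ring.
  rewrite normrM mulrCA ler_wpM2l //.
  rewrite (le_trans (dmonomial_diff _ _ _ s40 ws ts)) // sE [_ * dconst _ _ in leLHS]mulrC.
  by rewrite mulrA.
have main : (fun h : C => h^-1 *: ((f \o shift w) (h *: delta_mx 0 j) - f w : C^o))
    @ 0^' --> (l : C^o).
  apply/cvgrPdist_le => e e0.
  have ct : \forall t \near (0 : C),
      box_sum (fun al => a al * dmonomial be al (w + t *: delta_mx 0 j)) k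
      @[k --> \oo] --> f (w + t *: delta_mx 0 j).
    exact: (@cvg_line w (delta_mx 0 j) _ cw).
  near=> t.
  have t0 : t != 0 by near: t; apply: nbhs_dnbhs_neq.
  have ts : `|t| <= s4 by near: t; apply: dnbhs0_le.
  (* The error is at most |t| B <= e B / (B + 1) <= e; the added 1 covers B = 0. *)
  have te : `|t| <= e / (B + 1).
    by near: t; apply: dnbhs0_le; rewrite divr_gt0 // ltr_wpDl.
  have := bound t ts; rewrite /shift /=.
  have -> : l - t^-1 *: (f (t *: delta_mx 0 j + w) - f w : C^o) =
     - (t^-1 * (f (w + t *: delta_mx 0 j) - f w - t * l)).
    by rewrite [w + _]addrC /GRing.scale /=; field.
  rewrite normrN normrM normfV ler_pdivrMl ?normr_gt0 // => bt.
  apply: (le_trans (bt _)).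
    by near: t; apply: nbhs_dnbhs.
  rewrite expr2 -mulrA ler_wpM2l // (le_trans (ler_wpM2r B0 te)) //.
  rewrite -mulrA ler_piMr ?(ltW e0) // mulrC ler_pdivrMr ?ltr_wpDl // mul1r.
  by rewrite lerDl.
split; first by apply/cvg_ex; exists l.
exact: cvg_lim main.
Unshelve. all: by end_near. Qed.

End PowerSeries.

(** * Smooth germs and polynomial functions *)

Section Smooth.
Variables (R : realType) (N : nat).
Local Notation C := (Cfield R).
Local Notation V := 'rV[C]_N.
Local Notation idx := {ffun 'I_N -> nat}.
Implicit Types f g : V -> C.

Definition partial (j : 'I_N) f : V -> C := fun z => 'D_(delta_mx 0 j) (f : V -> C^o) z : C.

Definition near0_eq f g := \forall z \near (0 : V), f z = g z.

Definition near0_derivable f :=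
  \forall z \near (0 : V), forall j, derivable (f : V -> C^o) z (delta_mx 0 j).

(** The neighbourhood of the origin may shrink as [k] grows. *)
Fixpoint smooth_upto k f : Prop :=
  if k is k'.+1 then near0_derivable f /\ forall j, smooth_upto k' (partial j f) else True.

Definition smooth f := forall k, smooth_upto k f.

Lemma near0_eq_sym f g : near0_eq f g -> near0_eq g f.
Proof. by apply: filterS => z ->. Qed.

Lemma near0_eq_trans f g h : near0_eq f g -> near0_eq g h -> near0_eq f h.
Proof. by move=> fg gh; apply: filterS2 fg gh => z -> ->. Qed.

Lemma near0_eq_partial j f g : near0_eq f g -> near0_eq (partial j f) (partial j g).
Proof. by move=> /near_join; apply: filterS => z; apply: near_eq_derive. Qed.

Lemma near0_eq_derivable f g : near0_eq f g -> near0_derivable f -> near0_derivable g.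
Proof.
move=> /near_join fg; apply: filterS2 fg => z fg df j.
by apply: near_eq_derivable (df j).
Qed.

Lemma smooth_upto_near k f g : near0_eq f g -> smooth_upto k f -> smooth_upto k g.
Proof.
elim: k f g => [//|k IH] f g fg [df pf]; split; first exact: near0_eq_derivable fg df.
by move=> j; apply: IH (pf j); apply: near0_eq_partial.
Qed.

Lemma smooth_upto_pred k f : smooth_upto k.+1 f -> smooth_upto k f.
Proof. by elim: k f => [//|k IH] f [df pf]; split=> // j; apply: IH; apply: pf. Qed.

Lemma near0_partialD j f g : near0_derivable f -> near0_derivable g ->
  near0_eq (partial j (f + g)) (partial j f + partial j g).
Proof.
by apply: filterS2 => z df dg; rewrite /partial (deriveD (df j) (dg j)).
Qed.

Lemma near0_derivableD f g : near0_derivable f -> near0_derivable g ->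
  near0_derivable (f + g).
Proof. by apply: filterS2 => z df dg j; apply: derivableD. Qed.

Lemma near0_partialM j f g : near0_derivable f -> near0_derivable g ->
  near0_eq (partial j (f * g)) (partial j f * g + f * partial j g).
Proof.
apply: filterS2 => z df dg; rewrite /partial [LHS](deriveM (df j) (dg j)).
by rewrite addrC [g z *: _]mulrC.
Qed.

Lemma near0_derivableM f g : near0_derivable f -> near0_derivable g ->
  near0_derivable (f * g).
Proof. by apply: filterS2 => z df dg j; apply: (derivableM (df j) (dg j)). Qed.

Lemma smooth_uptoD k f g : smooth_upto k f -> smooth_upto k g -> smooth_upto k (f + g).
Proof.
elim: k f g => [//|k IH] f g [df pf] [dg pg]; split; first exact: near0_derivableD.
move=> j; apply: (smooth_upto_near (near0_eq_sym (near0_partialD j df dg))).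
exact: IH (pf j) (pg j).
Qed.

Lemma smooth_uptoM k f g : smooth_upto k f -> smooth_upto k g -> smooth_upto k (f * g).
Proof.
elim: k f g => [//|k IH] f g sf sg.
have [f' g'] := (smooth_upto_pred sf, smooth_upto_pred sg).
move: sf sg => /= [df pf] [dg pg]; split; first exact: near0_derivableM.
move=> j; apply: (smooth_upto_near (near0_eq_sym (near0_partialM j df dg))).
by apply: smooth_uptoD; [exact: IH (pf j) g'|exact: IH f' (pg j)].
Qed.

Lemma smoothD f g : smooth f -> smooth g -> smooth (f + g).
Proof. by move=> sf sg k; apply: smooth_uptoD. Qed.

Lemma smoothM f g : smooth f -> smooth g -> smooth (f * g).
Proof. by move=> sf sg k; apply: smooth_uptoM. Qed.

Lemma smooth_near f g : near0_eq f g -> smooth f -> smooth g.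
Proof. by move=> fg sf k; apply: smooth_upto_near (sf k). Qed.

Lemma smooth_partial j f : smooth f -> smooth (partial j f).
Proof. by move=> sf k; case: (sf k.+1) => _; apply. Qed.

Lemma smooth_derivable f : smooth f -> near0_derivable f.
Proof. by move=> /(_ 1%N) []. Qed.

Lemma derivable_cst_partial (c : C) z j :
  derivable ((fun=> c) : V -> C^o) z (delta_mx 0 j) /\ partial j (fun=> c) z = 0.
Proof. by split; [exact: derivable_cst|rewrite /partial derive_cst]. Qed.

Lemma smooth_cst (c : C) : smooth (fun=> c).
Proof.
move=> k; elim: k c => [//|k IH] c; split.
  by apply: (@filterE _ (nbhs (0 : V))) => z j; case: (derivable_cst_partial c z j).
move=> j; have -> : partial j (fun=> c) = fun=> 0; last exact: IH.
by apply/funext => z; case: (derivable_cst_partial c z j).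
Qed.

Lemma smooth_sum (I : Type) (r : seq I) (Q : pred I) (F : I -> V -> C) :
  (forall i, Q i -> smooth (F i)) -> smooth (\sum_(i <- r | Q i) F i).
Proof. by move=> H; elim/big_ind: _ => //; [exact: smooth_cst|exact: smoothD]. Qed.

Lemma near0_eqxx f : near0_eq f f.
Proof. exact: (@filterE _ (nbhs (0 : V))). Qed.

Lemma near0_eqD f f' g g' : near0_eq f f' -> near0_eq g g' -> near0_eq (f + g) (f' + g').
Proof. by apply: filterS2 => z fz gz; rewrite -[LHS]/(f z + g z) fz gz. Qed.

Lemma near0_eq_sum (I : Type) (r : seq I) (Q : pred I) (F F' : I -> V -> C) :
  (forall i, Q i -> near0_eq (F i) (F' i)) ->
  near0_eq (\sum_(i <- r | Q i) F i) (\sum_(i <- r | Q i) F' i).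
Proof.
move=> H; apply: (big_ind2 near0_eq) => //; first exact: near0_eqxx.
by move=> *; apply: near0_eqD.
Qed.

Lemma near0_partial_sum j n (F : 'I_n -> V -> C) : (forall i, smooth (F i)) ->
  near0_eq (partial j (\sum_i F i)) (\sum_i partial j (F i)).
Proof.
elim: n F => [|n IH] F sF.
  rewrite !big_ord0; have -> : partial j 0 = 0; last exact: near0_eqxx.
  by apply/funext => z; case: (derivable_cst_partial 0 z j).
rewrite !big_ord_recl; apply: near0_eq_trans (near0_partialD j _ _) _.
- exact: smooth_derivable.
- by apply/smooth_derivable/smooth_sum.
by apply: near0_eqD; [exact: near0_eqxx|apply: IH].
Qed.

Lemma termwise_smooth a be f : termwise a be f -> smooth f.
Proof.
move=> T k; elim: k be f T => [//|k IH] be f T; split.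
  apply: (@filter_forall _ _ _ (nbhs (0 : V))) => j; by case: (termwise_derive j T).
by move=> j; have [_ T'] := termwise_derive j T; apply: IH T'.
Qed.

Lemma holomorphic_smooth f : holomorphic_near0 f -> smooth f.
Proof. by move=> /nbhs_singleton/power_series_termwise[a /termwise_smooth]. Qed.

End Smooth.

(** * Polynomial functions are holomorphic and closed under partial derivatives *)

Section PolynomialFunctions.
Variables (R : realType) (N : nat).
Local Notation C := (Cfield R).
Local Notation V := 'rV[C]_N.
Local Notation idx := {ffun 'I_N -> nat}.

Inductive polyfun : (V -> C) -> Prop :=
| polyfun_cst c : polyfun (fun=> c)
| polyfun_coord i : polyfun (fun w => w 0 i)
| polyfun_add f g : polyfun f -> polyfun g -> polyfun (f + g)
| polyfun_mul f g : polyfun f -> polyfun g -> polyfun (f * g).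

Definition addidx (al be : idx) : idx := [ffun i => al i + be i]%N.

Lemma monomialD (al be : idx) (w : V) :
  monomial (addidx al be) w = monomial al w * monomial be w.
Proof. by rewrite -big_split; apply: eq_bigr => i _; rewrite ffunE exprD. Qed.

Lemma monomial0 (w : V) : monomial [ffun=> 0%N] w = 1.
Proof. by rewrite /monomial big1 // => i _; rewrite ffunE. Qed.

(** Exponents may repeat in the list, so sums are concatenations and products are lists of pairwise
    products. *)
Lemma polyfun_expansion f (z : V) : polyfun f -> exists L : seq (C * idx),
  forall w, f w = \sum_(l <- L) l.1 * monomial l.2 (w - z).
Proof.
elim=> {f} [c|i|f g _ [L HL] _ [L' HL']|f g _ [L HL] _ [L' HL']].
- by exists [:: (c, [ffun=> 0%N])] => w; rewrite big_seq1 monomial0 mulr1.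
- exists [:: (z 0 i, [ffun=> 0%N]); (1, [ffun j => (j == i) : nat])] => w.
  rewrite big_cons big_seq1 /= monomial0 mulr1 mul1r /monomial (bigD1 i) //= ffunE eqxx.
  rewrite big1 ?mulr1 => [|j ji]; first by rewrite expr1 !mxE addrCA subrr addr0.
  by rewrite ffunE (negPf ji).
- by exists (L ++ L') => w; rewrite big_cat -HL -HL'.
- exists [seq (l.1 * l'.1, addidx l.2 l'.2) | l <- L, l' <- L'] => w.
  rewrite big_allpairs_dep /= -[LHS]/(f w * g w) HL HL' big_distrlr /=.
  apply: eq_bigr => l _; apply: eq_bigr => l' _.
  by rewrite monomialD mulrACA.
Qed.

Lemma box_sum_indicator (be : idx) k :
  box_sum (fun al => (al == be)%:R : C) k = [forall i, be i < k]%N%:R.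
Proof.
have [H|] := boolP [forall i, be i < k]%N; last first.
  rewrite negb_forall => H0; case/existsP: H0 => i; rewrite -leqNgt => ki.
  rewrite /box_sum big1 // => al _.
  rewrite (_ : _ == be = false) //; apply/eqP => /ffunP/(_ i); rewrite ffunE => E.
  by have := ltn_ord (al i); rewrite E ltnNge ki.
pose al0 : {ffun 'I_N -> 'I_k} := [ffun i => Ordinal (forallP H i)].
rewrite /box_sum (bigD1 al0) //= big1 => [|al al0N].
  by rewrite addr0 (_ : _ == be) //; apply/eqP/ffunP => i; rewrite !ffunE.
rewrite (_ : _ == be = false) //; apply: contraNF al0N => /eqP/ffunP E.
by apply/eqP/ffunP => i; apply: val_inj; rewrite /= -[LHS](ffunE (fun i => al i : nat)) E ffunE.
Qed.

Lemma box_sum_seq (L : seq (C * idx)) (g : C * idx -> C) k :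
  box_sum (fun al => \sum_(l <- L) g l * (al == l.2)%:R) k =
  \sum_(l <- L) g l * [forall i, l.2 i < k]%N%:R.
Proof.
rewrite /box_sum exchange_big /=; apply: eq_bigr => l _.
by rewrite -box_sum_indicator -box_sumZ.
Qed.

Lemma polyfun_holomorphic f : polyfun f -> holomorphic_near0 f.
Proof.
move=> pf; apply: (@filterE _ (nbhs (0 : V))) => z; have [L HL] := polyfun_expansion z pf.
exists (fun al => \sum_(l <- L) l.1 * (al == l.2)%:R).
apply: (@filterE _ (nbhs z)) => w; rewrite HL.
have tE al : (\sum_(l <- L) l.1 * (al == l.2)%:R) * monomial al (w - z) =
    \sum_(l <- L) (l.1 * monomial l.2 (w - z)) * (al == l.2)%:R.
  rewrite mulr_suml; apply: eq_bigr => l _.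
  by case: eqP => [->|_]; rewrite ?mulr1 // !mulr0 mul0r.
split.
  exists (\sum_(l <- L) `|l.1 * monomial l.2 (w - z)|) => k.
  pose u al := \sum_(l <- L) `|l.1 * monomial l.2 (w - z)| * (al == l.2)%:R.
  have tu al : `|(\sum_(l <- L) l.1 * (al == l.2)%:R) * monomial al (w - z)| <= u al.
    rewrite tE (le_trans (ler_norm_sum _ _ _)) // ler_sum // => l _.
    by rewrite normrM normr_nat.
  apply: le_trans (box_sum_le k tu) _.
  rewrite box_sum_seq ler_sum // => l _.
  by case: [forall _, _]; rewrite ?mulr1 // mulr0.
(* From [K] on the box contains every exponent of the list, and the box sums are constant. *)
pose K := (\max_(l <- L) \max_i (l.2 i).+1)%N.
apply: cvg_near_cst; exists K => // k /= Kk.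
rewrite (funext tE).
rewrite box_sum_seq; apply: eq_big_seq => l lL.
rewrite (_ : [forall i, _]) ?mulr1 //; apply/forallP => i.
apply: leq_trans Kk; rewrite /K (big_rem l) //= leq_max; apply/orP; left.
exact: (leq_bigmax i).
Qed.

Lemma derivable_coord (i j : 'I_N) (z : V) :
  is_derive z (delta_mx 0 j) ((fun w : V => w 0 i) : V -> C^o) (i == j)%:R.
Proof.
have main : (fun h : C => h^-1 *: ((((fun w : V => w 0 i) : V -> C^o) \o shift z)
    (h *: delta_mx 0 j) - z 0 i)) @ 0^' --> ((i == j)%:R : C^o).
  apply: cvg_near_cst; near=> h.
  have h0 : h != 0 by near: h; apply: nbhs_dnbhs_neq.
  by rewrite /= !mxE eqxx addrK /GRing.scale /= mulrA mulVf // mul1r.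
split; first by apply/cvg_ex; exists (i == j)%:R.
exact: cvg_lim main.
Unshelve. all: by end_near. Qed.

Lemma polyfun_partial f : polyfun f ->
  (forall z j, derivable (f : V -> C^o) z (delta_mx 0 j)) /\ forall j, polyfun (partial j f).
Proof.
elim=> {f} [c|i|f g pf [df pdf] pg [dg pdg]|f g pf [df pdf] pg [dg pdg]]; split.
- by move=> z j; case: (derivable_cst_partial c z j).
- move=> j; have -> : partial j (fun=> c) = (fun=> 0 : C); last exact: polyfun_cst.
  by apply/funext => z; case: (derivable_cst_partial c z j).
- by move=> z j; have [] := derivable_coord i j z.
- move=> j; have -> : partial j (fun w : V => w 0 i) = (fun=> (i == j)%:R : C).
    by apply/funext => z; have [_] := derivable_coord i j z.
  exact: polyfun_cst.
- by move=> z j; apply: derivableD.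
- move=> j; have -> : partial j (f + g) = partial j f + partial j g.
    by apply/funext => z; apply: (deriveD (df z j) (dg z j)).
  exact: polyfun_add.
- by move=> z j; apply: (derivableM (df z j) (dg z j)).
- move=> j; have -> : partial j (f * g) = partial j f * g + f * partial j g.
    apply/funext => z; rewrite /partial [LHS](deriveM (df z j) (dg z j)).
    by rewrite addrC [g z *: _]mulrC.
  by apply: polyfun_add; apply: polyfun_mul.
Qed.

End PolynomialFunctions.

(** * The ring of polynomial functions, to which the algebraic stages apply *)

Section PolynomialRing.
Variables (R : realType) (N : nat).
Local Notation C := (Cfield R).
Local Notation V := 'rV[C]_N.

Definition is_polyfun : {pred V -> C} := fun f => `[<polyfun f>].

Lemma is_polyfun_subring : subring_closed is_polyfun.
Proof.
have opp f : polyfun f -> polyfun (- f).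
  move=> pf; have -> : - f = (fun=> -1) * f by apply/funext => z; rewrite -[LHS]mulN1r.
  by apply: polyfun_mul => //; apply: polyfun_cst.
split=> [|f g|f g]; rewrite -!topredE /= /is_polyfun.
- by apply/asboolP; apply: polyfun_cst.
- by move=> /asboolP pf /asboolP pg; apply/asboolP/polyfun_add => //; apply: opp.
- by move=> /asboolP pf /asboolP pg; apply/asboolP/polyfun_mul.
Qed.

HB.instance Definition _ := GRing.isSubringClosed.Build (V -> C) is_polyfun is_polyfun_subring.

Record polyring := PolyFun { polyring_val : V -> C; _ : polyring_val \in is_polyfun }.

HB.instance Definition _ := [isSub for polyring_val].
HB.instance Definition _ := [Choice of polyring by <:].
HB.instance Definition _ := [SubChoice_isSubComNzRing of polyring by <:].

Lemma polyringP (f : polyring) : polyfun (val f).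
Proof. by case: f => f /= fP; apply/asboolP. Qed.

Definition mkpoly f (pf : polyfun f) : polyring := PolyFun (introT (asboolP _) pf).

Definition poly_cst (c : C) : polyring := mkpoly (polyfun_cst N c).

Definition poly_coord (i : 'I_N) : polyring := mkpoly (polyfun_coord R i).

Definition dpartial (j : 'I_N) (f : polyring) : polyring :=
  mkpoly ((polyfun_partial (polyringP f)).2 j).

Lemma dpartial_derivation j : derivation (dpartial j).
Proof.
split=> f g; apply: val_inj; apply/funext => z.
  have [df _] := polyfun_partial (polyringP f); have [dg _] := polyfun_partial (polyringP g).
  exact: (deriveD (df z j) (dg z j)).
have [df _] := polyfun_partial (polyringP f); have [dg _] := polyfun_partial (polyringP g).
rewrite /= /partial [LHS](deriveM (df z j) (dg z j)).
by rewrite addrC [val g z *: _]mulrC.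
Qed.

Definition evaluate (z : V) (f : polyring) : C := val f z.

Lemma evaluate_is_zmod z : zmod_morphism (evaluate z).
Proof. by move=> f g. Qed.

Lemma evaluate_is_monoid z : monoid_morphism (evaluate z).
Proof. by split. Qed.

HB.instance Definition _ z := GRing.isZmodMorphism.Build polyring C
  (evaluate z) (evaluate_is_zmod z).
HB.instance Definition _ z := GRing.isMonoidMorphism.Build polyring C
  (evaluate z) (evaluate_is_monoid z).

(** Made a ring morphism so that evaluation at a point commutes with sums and determinants of
    functions. *)
Definition evalfun (z : V) (f : V -> C) : C := f z.

Lemma evalfun_is_zmod z : zmod_morphism (evalfun z).
Proof. by move=> f g. Qed.

Lemma evalfun_is_monoid z : monoid_morphism (evalfun z).
Proof. by split. Qed.

HB.instance Definition _ z := GRing.isZmodMorphism.Build (V -> C) C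
  (evalfun z) (evalfun_is_zmod z).
HB.instance Definition _ z := GRing.isMonoidMorphism.Build (V -> C) C
  (evalfun z) (evalfun_is_monoid z).

Lemma polyring_natV m : (0 < m)%N -> exists u : polyring, u * m%:R = 1.
Proof.
move=> m0; exists (poly_cst (m%:R^-1)); apply: val_inj; apply/funext => z.
rewrite -[LHS]/(evaluate z _) rmorphM rmorph_nat /evaluate /=.
by rewrite mulVf // pnatr_eq0 -lt0n.
Qed.

Lemma smooth_polyring (f : polyring) : smooth (val f).
Proof. exact/holomorphic_smooth/polyfun_holomorphic/polyringP. Qed.

Lemma dpartial_coord i j : dpartial j (poly_coord i) = (i == j)%:R.
Proof.
apply: val_inj; apply/funext => z; rewrite /= /partial.
rewrite (derive_val (is_derive := derivable_coord i j z)).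
by rewrite -[RHS]/(evaluate z _) rmorph_nat.
Qed.

End PolynomialRing.

(** * Jacobian extensions of the stage ideals *)

Section Ideals.
Variables (R : realType) (N : nat).
Local Notation C := (Cfield R).
Local Notation V := 'rV[C]_N.
Local Notation P := (polyring R N).
Implicit Types (G : seq P) (F : V -> C) (T : set (V -> C)).

Definition smooth_span G F := exists h : nat -> V -> C,
  (forall i, smooth (h i)) /\ near0_eq F (\sum_(i < size G) h i * val G`_i).

Lemma smooth_span_near G F F' : near0_eq F F' -> smooth_span G F -> smooth_span G F'.
Proof.
move=> FF' [h [hs hF]]; exists h; split=> //.
exact: near0_eq_trans (near0_eq_sym FF') hF.
Qed.

Lemma smooth_span_smooth G F : smooth_span G F -> smooth F.
Proof.
case=> h [hs /near0_eq_sym hF]; apply: (smooth_near hF).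
by apply: smooth_sum => i _; apply: smoothM => //; apply: smooth_polyring.
Qed.

Lemma smooth_span_ideal G : is_ideal (@smooth R N) (smooth_span G).
Proof.
split.
- exists (fun=> 0); split=> [i|]; first exact: smooth_cst.
  by rewrite big1 => [|i _]; [apply: near0_eqxx|rewrite mul0r].
- move=> F F' [h [hs hF]] [h' [hs' hF']]; exists (fun i => h i + h' i).
  split=> [i|]; first exact: smoothD.
  apply: filterS2 hF hF' => z Fz F'z.
  rewrite -[LHS]/(F z + F' z) Fz F'z -[LHS]/((_ + _) z); congr (_ z).
  by rewrite -big_split; apply: eq_bigr => i _; rewrite mulrDl.
- move=> c F cs [h [hs hF]]; exists (fun i => c * h i).
  split=> [i|]; first exact: smoothM.
  apply: filterS hF => z Fz.
  rewrite -[LHS]/(c z * F z) Fz -[LHS]/((_ * _) z); congr (_ z).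
  by rewrite mulr_sumr; apply: eq_bigr => i _; rewrite mulrA.
Qed.

Lemma val_polysum (I : Type) (r : seq I) (Q : pred I) (f : I -> P) :
  val (\sum_(i <- r | Q i) f i) = \sum_(i <- r | Q i) val (f i).
Proof. exact: rmorph_sum. Qed.

Lemma smooth_span_val G f : ideal_span G f -> smooth_span G (val f).
Proof.
case=> c ->; exists (fun i => val (c i)); split=> [i|]; first exact: smooth_polyring.
rewrite val_polysum; exact: near0_eqxx.
Qed.

Lemma smooth_span_sub G G' F : (forall i, ideal_span G' G`_i) ->
  smooth_span G F -> smooth_span G' F.
Proof.
move=> GG' [h [hs /near0_eq_sym hF]]; apply: (smooth_span_near hF).
have [_ _ IM] := smooth_span_ideal G'.
apply: (ideal_sum (smooth_span_ideal G')) => i _; apply: IM => //.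
exact: smooth_span_val.
Qed.

(** * Jacobian extension of an ideal lying between a polynomial and a smooth span *)

Section Step.
Variables (G G' : seq P) (s t : nat) (T : set (V -> C)).
Hypothesis lower : forall f, ideal_span G f -> T (val f).
Hypothesis upper : forall F, T F -> smooth_span G F.
Hypothesis GG' : forall i, ideal_span G' G`_i.
Hypothesis G'0 : forall f, ideal_span G' f -> val f 0 = 0.
Hypothesis factor : exists (X : nat -> nat -> P) (Y : nat -> 'I_N -> P),
  forall i j, (i < size G)%N ->
    ideal_span G' (dpartial j G`_i - \sum_(l < N - t) X i l * Y l j).

(** Write F as a combination of [G] with smooth coefficients and differentiate: terms with
    differentiated coefficients lie in the span of [G'], the others inherit the factorization of the
    derivatives of [G]. *)
Lemma jacobian_cong k (F : 'I_k -> V -> C) : (forall i, T (F i)) ->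
  exists (X : 'I_k -> 'I_(N - t) -> V -> C) (Y : 'I_(N - t) -> 'I_N -> V -> C),
  [/\ forall i l, smooth (X i l), forall l j, smooth (Y l j) &
    forall i j, smooth_span G' (partial j (F i) - \sum_l X i l * Y l j)].
Proof.
move=> FT; have [X [Y XY]] := factor.
have /boolp.choice[h hP] : forall i, exists h : nat -> V -> C,
    (forall i, smooth (h i)) /\ near0_eq (F i) (\sum_(i < size G) h i * val G`_i).
  by move=> i; apply: upper.
exists (fun i l => \sum_(m < size G) h i m * val (X m l)), (fun l j => val (Y l j)); split.
- move=> i l; apply: smooth_sum => m _; apply: smoothM; last exact: smooth_polyring.
  by case: (hP i).
- by move=> l j; apply: smooth_polyring.
move=> i j; have [hs hF] := hP i.
have HI := smooth_span_ideal G'; have [I0 ID IM] := HI.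
have sG m : smooth (val G`_m) by apply: smooth_polyring.
have dF : near0_eq (\sum_(m < size G)
    (partial j (h i m) * val G`_m + h i m * val (dpartial j G`_m))) (partial j (F i)).
  apply: near0_eq_sym; apply: near0_eq_trans (near0_eq_partial j hF) _.
  apply: near0_eq_trans (near0_partial_sum j _) _ => [m|]; first exact: smoothM.
  by apply: near0_eq_sum => m _; apply: near0_partialM; apply: smooth_derivable.
apply: (smooth_span_near (near0_eqD dF (near0_eqxx _))).
under [X in _ - X]eq_bigr do rewrite mulr_suml.
rewrite exchange_big /= -sumrB; apply: (ideal_sum HI) => m _.
rewrite -addrA; apply: ID.
  by apply: (IM) => //; [exact: smooth_partial|apply/smooth_span_val/GG'].
have := smooth_span_val (XY m j (ltn_ord m)).
move/(IM (h i m) _ (hs m)); congr (smooth_span _ _).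
rewrite rmorphB mulrBr rmorph_sum mulr_sumr; congr (_ - _).
by apply: eq_bigr => l _; rewrite rmorphM mulrA.
Qed.

(** The minor is congruent to the determinant of a product through dimension N - t, which is 0 at
    every point. *)
Lemma minors_smooth_span F : jacobian_minors T (N - t + 1) F -> smooth_span G' F.
Proof.
case=> m [F0 [rows [cols [F0T _ _ ->]]]].
have [X [Y [Xs Ys XY]]] := jacobian_cong F0T.
pose A := \matrix_(i < N - t + 1, j < N - t + 1) partial (cols j) (F0 (rows i)).
pose B := \matrix_(i < N - t + 1, j < N - t + 1) \sum_l X (rows i) l * Y l (cols j).
have -> : (fun z => \det (mxsub rows cols (jacobian_mx F0 z))) = \det A.
  apply/funext => z; rewrite -[RHS]/(evalfun z _) -det_map_mx; congr (\det _).
  by apply/matrixP => i j; rewrite !mxE.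
have -> : \det A = \det A - \det B.
  rewrite (_ : \det B = 0) ?subr0 //; apply/funext => z.
  rewrite -[LHS]/(evalfun z _) -det_map_mx.
  have -> : map_mx (evalfun z) B = (\matrix_(i < N - t + 1, l < N - t) X (rows i) l z) *m
      (\matrix_(l < N - t, j < N - t + 1) Y l (cols j) z).
    apply/matrixP => i j; rewrite !mxE rmorph_sum; apply: eq_bigr => l _.
    by rewrite rmorphM !mxE.
  by apply: det_mulmx_thin; rewrite addn1.
have sN1 : smooth (-1 : V -> C).
  have -> : (-1 : V -> C) = (fun=> -1) by [].
  exact: smooth_cst.
apply: (@det_cong _ (@smooth R N) _ _ _ _ (smooth_span_ideal G')) => //.
- exact: smooth_cst.
- by move=> f g; apply: smoothM.
- by move=> i j; rewrite mxE; apply/smooth_partial/(smooth_span_smooth (upper (F0T _))).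
- by move=> i j; rewrite mxE; apply: smooth_sum => l _; apply: smoothM.
by move=> i j; rewrite !mxE.
Qed.

Lemma upper_next F : jacobian_ext (N - t + 1) T F -> smooth_span G' F.
Proof.
case=> m [h [f [hh fT hF]]].
have [_ _ IM] := smooth_span_ideal G'.
have : smooth_span G' (\sum_i h i * f i).
  apply: (ideal_sum (smooth_span_ideal G')) => i _; apply: (IM); first exact: holomorphic_smooth.
  case: (fT i) => [/upper|]; first exact: smooth_span_sub.
  exact: minors_smooth_span.
apply: smooth_span_near; apply: near0_eq_sym.
apply: filterS hF => z ->; rewrite -[RHS]/(evalfun z _) rmorph_sum.
by apply: eq_bigr => i _; rewrite rmorphM.
Qed.

(** At the origin the span of [G'] vanishes, so the congruence becomes an exact factorization
    through dimension N - t. *)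
Lemma rank_le k (F : 'I_k -> V -> C) : (forall i, T (F i)) ->
  row_free (jacobian_mx F 0) -> (k <= N - t)%N.
Proof.
move=> FT /eqP rF; have [X [Y [Xs Ys XY]]] := jacobian_cong FT.
suff E : jacobian_mx F 0 = (\matrix_(i < k, l < N - t) X i l 0) *m
    (\matrix_(l < N - t, j < N) Y l j 0).
  by rewrite -rF E (leq_trans (mxrankM_maxl _ _)) // rank_leq_col.
apply/matrixP => i j; have [h [hs hF]] := XY i j.
have : evalfun 0 (partial j (F i) - \sum_l X i l * Y l j) = 0.
  rewrite [LHS](nbhs_singleton hF) -[LHS]/(evalfun 0 _) rmorph_sum big1 // => m _.
  by rewrite rmorphM [X in _ * X]G'0 ?mulr0 //; apply: span_nth.
move/eqP; rewrite rmorphB subr_eq0 => /eqP E.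
rewrite !mxE -[LHS]/(evalfun 0 (partial j (F i))) E rmorph_sum.
by apply: eq_bigr => l _; rewrite !mxE rmorphM.
Qed.

Lemma corank_eq : (t <= N)%N ->
  (exists F : 'I_(N - t) -> P, (forall i, ideal_span G (F i)) /\
    row_free (\matrix_(i, j) evaluate 0 (dpartial j (F i)))) ->
  ideal_corank T = t.
Proof.
move=> tN [F [FG rF]].
rewrite /ideal_corank; suff -> : ideal_rank T = (N - t)%N by rewrite subKn.
apply/eqP; rewrite eqn_leq; apply/andP; split.
  by apply/bigmax_leqP => k /asboolP[F' [F'T rF']]; apply: rank_le F'T rF'.
have lt : (N - t < N.+1)%N by rewrite ltnS leq_subr.
apply: (@leq_bigmax_cond _ _ (fun k : 'I_N.+1 => k : nat) (Ordinal lt)).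
apply/asboolP; exists (fun i => val (F i)); split=> [i|]; first exact: lower.
by move: rF; congr (is_true (row_free _)); apply/matrixP => i j; rewrite !mxE.
Qed.

Hypothesis minors : forall Z : P -> Prop, is_ideal (fun=> True) Z ->
  (forall f, ideal_span G f -> Z f) ->
  (forall (F : 'I_(N - t + 1) -> P) (cols : 'I_(N - t + 1) -> 'I_N),
      (forall i, ideal_span G (F i)) -> {homo cols : i j / (i < j)%N} ->
      Z (\det (\matrix_(i, j) dpartial (cols j) (F i)))) ->
  forall f, ideal_span G' f -> Z f.

(** The hypothesis [minors] is applied to the polynomials that are combinations, with polynomial
    coefficients, of elements of [T] and minors; this [Z] is visibly an ideal, and its coefficients
    are holomorphic. *)
Lemma lower_next f : ideal_span G' f -> jacobian_ext (N - t + 1) T (val f).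
Proof.
pose gen F := T F \/ jacobian_minors T (N - t + 1) F.
pose Z (f : P) := exists m (h : nat -> P) (s : nat -> V -> C),
  (forall i, gen (s i)) /\ val f = \sum_(i < m) val (h i) * s i.
(* Families are indexed by all natural numbers, so even the empty combination must name a
   generator. *)
have T0 : T 0 by apply: (lower (f := 0)); case: (span_ideal G).
suff ZG' : forall f, ideal_span G' f -> Z f.
  move=> /ZG'[m [h [g [gg E]]]]; exists m, (fun i => val (h i)), (fun i => g i); split.
  - by move=> i; apply/polyfun_holomorphic/polyringP.
  - by move=> i; apply: gg.
  apply: (@filterE _ (nbhs (0 : V))) => z; rewrite E -[LHS]/(evalfun z _) rmorph_sum.
  by apply: eq_bigr => i _; rewrite rmorphM.
have Zgen g : gen (val g) -> Z g.
  move=> gg; exists 1%N, (fun=> 1), (fun=> val g); split=> //.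
  by rewrite big_ord1 mul1r.
apply: minors => [|g Gg|F cols FG cols_homo].
- split.
  + by exists 0%N, (fun=> 0), (fun=> 0); split=> [_|]; [left|rewrite big_ord0].
  + move=> g g' [m [h [u [uu E]]]] [m' [h' [u' [uu' E']]]].
    exists (m + m')%N, (fun i => if (i < m)%N then h i else h' (i - m)%N).
    exists (fun i => if (i < m)%N then u i else u' (i - m)%N); split=> [i|].
      by case: ifP.
    rewrite -[LHS]/(val g + val g') E E' big_split_ord /=; congr (_ + _); apply: eq_bigr => i _.
      by rewrite ltn_ord.
    by rewrite ltnNge leq_addr /= addKn.
  + move=> c g _ [m [h [u [uu E]]]]; exists m, (fun i => c * h i), u; split=> //.
    rewrite -[LHS]/(val c * val g) E mulr_sumr; apply: eq_bigr => i _.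
    by rewrite mulrA.
- by apply: Zgen; left; apply: lower.
apply: Zgen; right; exists (N - t + 1)%N, (fun i => val (F i)), id, cols; split=> //.
  by move=> i; apply: lower.
apply/funext => z; rewrite -[LHS]/(evaluate z _) -det_map_mx; congr (\det _).
by apply/matrixP => i j; rewrite !mxE.
Qed.

End Step.

End Ideals.

(** * The multiplication map *)

Section BaseStage.
Variables (R : realType) (n r : nat).
Local Notation N := (n + r)%N.
Local Notation C := (Cfield R).
Local Notation V := 'rV[C]_N.
Local Notation P := (polyring R N).

Definition generic_monic d (c : 'I_d -> 'I_N) : {poly P} :=
  'X^d + rVpoly (\row_i poly_coord R (c i)).

Definition generic_f := generic_monic (lshift r).
Definition generic_g := generic_monic (@rshift n r).

Lemma size_rVpoly_lt (S : nzRingType) d (v : 'rV[S]_d) : (size (rVpoly v) < d.+1)%N.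
Proof. by rewrite ltnS size_poly. Qed.

Lemma generic_monic_size d (c : 'I_d -> 'I_N) : size (generic_monic c) = d.+1.
Proof. by rewrite size_polyDl size_polyXn // size_rVpoly_lt. Qed.

Lemma generic_monic_monic d (c : 'I_d -> 'I_N) : generic_monic c \is monic.
Proof.
by rewrite monicE lead_coefDl ?size_polyXn ?size_rVpoly_lt // lead_coefXn.
Qed.

Lemma map_generic_monic d (c : 'I_d -> 'I_N) z :
  map_poly (evaluate z) (generic_monic c) = monic_poly (\row_i z 0 (c i)).
Proof.
rewrite /generic_monic /monic_poly rmorphD /= map_polyXn map_rVpoly; congr (_ + rVpoly _).
by apply/rowP => i; rewrite !mxE.
Qed.

Lemma act_generic d (c : 'I_d -> 'I_N) (w : 'I_N -> P) (k : {poly P}) :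
  (size k <= d)%N -> (forall i, w (c i) = k`_i) ->
  dpoly (field_act (@dpartial R N) w) (generic_monic c) = k.
Proof.
move=> sk wk; have Dw := field_act_derivation (@dpartial_derivation R N) w.
have [DD _] := dpoly_derivation Dw; rewrite DD (dpolyXn Dw) add0r.
apply/polyP => i; rewrite (coef_dpoly Dw) coef_rVpoly.
case: insubP => [j _ <-|]; last first.
  by rewrite -leqNgt => di; rewrite (der0 Dw) nth_default // (leq_trans sk).
rewrite mxE /field_act (bigD1 (c j)) //= dpartial_coord eqxx mulr1 wk big1 ?addr0 //.
by move=> l lj; rewrite dpartial_coord eq_sym (negPf lj) mulr0.
Qed.

Lemma base_stage : (0 < r)%N -> (r <= n)%N ->
  stage (@dpartial R N) (evaluate 0) [::] generic_f generic_g n r 1 1.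
Proof.
move=> r0 rn; split; rewrite ?generic_monic_size ?generic_monic_monic //.
- by rewrite !mul1n.
- by move=> i; rewrite nth_nil rmorph0.
- rewrite map_generic_monic /monic_poly (_ : \row_i _ = 0) ?raddf0 ?addr0 //.
  by apply/rowP => i; rewrite !mxE.
- rewrite map_generic_monic /monic_poly (_ : \row_i _ = 0) ?raddf0 ?addr0 //.
  by apply/rowP => i; rewrite !mxE.
move=> eta pi kappa spi skap.
(* The nonleading coefficients are the coordinates themselves, so the prescribed derivatives are the
   components of the field. *)
exists (fun i => match fintype.split i with inl j => pi`_j | inr j => kappa`_j end); split=> //.
- apply: act_generic => // i; by rewrite (unsplitK (inl i)).
- apply: act_generic => // i; by rewrite (unsplitK (inr i)).
Qed.

Let G := gens N [::] generic_f generic_g 1 1.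

Lemma base_gens (r0 : (0 < r)%N) (rn : (r <= n)%N) (i : 'I_N) :
  val G`_i = fun z => mult_map z 0 (rev_ord i).
Proof.
apply/funext => z; rewrite -[LHS]/(evaluate z _).
rewrite gens_nth ?(size_stage_poly (base_stage r0 rn)) //= subn0.
rewrite -coef_map mxE rev_ordK /stage_poly rmorphB rmorphM !rmorphXn /= !map_generic_monic.
rewrite map_polyX !expr1 coefB coefXn (ltn_eqF (ltn_ord i)) subr0.
rewrite (_ : \row_j _ = lsubmx z); last by apply/rowP => j; rewrite !mxE.
by rewrite (_ : \row_j _ = rsubmx z) //; apply/rowP => j; rewrite !mxE.
Qed.

Lemma size_base : size G = N.
Proof. by rewrite size_gens. Qed.

Lemma base_lower f : (0 < r)%N -> (r <= n)%N -> ideal_span G f -> mult_ideal R n r (val f).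
Proof.
move=> r0 rn [c ->]; exists N, (fun i => val (c i)), (fun i => val G`_i); split.
- by move=> i; apply/polyfun_holomorphic/polyringP.
- by move=> i; exists (rev_ord i); apply: base_gens.
apply: (@filterE _ (nbhs (0 : V))) => z; rewrite -[LHS]/(evaluate z _) size_base rmorph_sum.
by apply: eq_bigr => i _; rewrite rmorphM.
Qed.

Lemma base_upper F : (0 < r)%N -> (r <= n)%N -> mult_ideal R n r F -> smooth_span G F.
Proof.
move=> r0 rn [m [h [s [hh sT hF]]]].
have [_ _ IM] := smooth_span_ideal G.
have : smooth_span G (\sum_i h i * s i).
  apply: (ideal_sum (smooth_span_ideal G)) => i _; apply: (IM); first exact: holomorphic_smooth.
  have [j ->] := sT i; rewrite -(rev_ordK j) -base_gens //.
  exact/smooth_span_val/span_nth.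
apply: smooth_span_near; apply: near0_eq_sym.
apply: filterS hF => z ->; rewrite -[RHS]/(evalfun z _) rmorph_sum.
by apply: eq_bigr => i _; rewrite rmorphM.
Qed.

(** * Iterating the step: coranks follow subtraction on sorted pairs of degrees *)

Definition sub_step (st : nat * nat) := (maxn (st.1 - st.2) st.2, minn (st.1 - st.2) st.2).

Definition invariant (T : set (V -> C)) st := exists G : seq P,
  [/\ at_stage (@dpartial R N) (evaluate 0) G st.1 st.2,
    forall f, ideal_span G f -> T (val f) &
    forall F, T F -> smooth_span G F].

Lemma invariant_step T st : invariant T st ->
  ideal_corank T = st.2 /\ invariant (jacobian_ext_up (ideal_corank T) T) (sub_step st).
Proof.
case: st => s t [G0 [/= st lower upper]].
have [G' [st' [GG' G'0] factor minors]] :=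
  at_stage_next (@dpartial_derivation R N) (@polyring_natV R N) st.
have cT : ideal_corank T = t.
  apply: (corank_eq lower upper GG' G'0 factor (at_stage_le st)).
  exact: (at_stage_row_free (@dpartial_derivation R N) st).
split=> //; exists G'; split=> //.
- by rewrite cT; apply: (lower_next lower minors).
- by rewrite cT; apply: (upper_next upper GG' factor).
Qed.

Lemma TB_entry_mult (r0 : (0 < r)%N) (rn : (r <= n)%N) k :
  TB_entry (mult_ideal R n r) k = (iter k sub_step (n, r)).2.
Proof.
suff H : invariant (TB_ideal (mult_ideal R n r) k) (iter k sub_step (n, r)).
  by case: (invariant_step H).
elim: k => [|k IH]; last by case: (invariant_step IH).
exists G; split=> [|f Gf|F TF]; [|exact: base_lower|exact: base_upper].
by split=> //; exists [::], generic_f, generic_g, 1%N, 1%N; split=> //; apply: base_stage.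
Qed.

End BaseStage.

(** * From subtraction to Euclidean division *)

Lemma iter_sub_step n r k : (0 < r)%N -> (r <= n)%N -> (k <= n %/ r)%N ->
  iter k sub_step (n, r) = (maxn (n - k * r) r, minn (n - k * r) r).
Proof.
move=> r0 rn; elim: k => [_|k IH kq]; first by rewrite mul0n subn0 (maxn_idPl rn) (minn_idPr rn).
rewrite iterS IH ?(ltnW kq) //.
have : (k.+1 * r <= n)%N by rewrite -leq_divRL.
by rewrite mulSn => kr; rewrite /sub_step /=; congr (_, _); lia.
Qed.

(** The first n / r subtractions all show the entry r and end at the sorted pair (r, n mod r), where
    the next division starts. Once the smaller degree is 0 it stays 0, matching the default of
    [nth]. *)
Lemma sub_step_euclid fuel n r k : (r <= fuel)%N -> (r <= n)%N ->
  (iter k sub_step (n, r)).2 = nth 0%N (euclid_steps fuel n r) k.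
Proof.
have zero m l : iter l sub_step (m, 0%N) = (m, 0%N).
  by elim: l => //= l ->; rewrite /sub_step /= subn0 maxn0 minn0.
elim: fuel n r k => [|fuel IH] n r k; first by rewrite leqn0 => /eqP-> _; rewrite zero nth_nil.
move=> rf rn /=; have [->|r0] := posnP r; first by rewrite zero nth_nil.
rewrite nth_cat size_nseq; case: ltnP => kq.
  rewrite iter_sub_step ?(ltnW kq) //= nth_nseq kq; apply/minn_idPr.
  have : (k.+1 * r <= n)%N by rewrite -leq_divRL.
  by rewrite mulSn; lia.
have -> : iter k sub_step (n, r) = iter (k - n %/ r) sub_step (r, n %% r)%N.
  rewrite -{1}(subnK kq) iterD iter_sub_step //.
  have E : (n - n %/ r * r = n %% r)%N by rewrite {1}(divn_eq n r) addKn.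
  have mr := ltn_pmod n r0.
  by rewrite E (maxn_idPr (ltnW mr)) (minn_idPl (ltnW mr)).
have mr := ltn_pmod n r0.
by apply: IH; [rewrite -ltnS (leq_trans mr)|exact: ltnW].
Qed.

Lemma euclid_steps_neq0 fuel n r : all (fun i => i != 0%N) (euclid_steps fuel n r).
Proof.
elim: fuel n r => //= fuel IH n r; case: eqVneq => [//|r0].
by rewrite all_cat IH all_nseq r0 orbT.
Qed.

Theorem theorem1p2 (R : realType) (n r : nat) (hr : (1 <= r)%N) (hn : (r <= n)%N) :
  TB_symbol (mult_ideal R n r) (euclid_tuple n r).
Proof.
split=> [k|]; first by rewrite TB_entry_mult // (@sub_step_euclid r).
have := euclid_steps_neq0 r n r; rewrite /euclid_tuple; case/lastP: (euclid_steps r n r) => // s x.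
by rewrite all_rcons last_rcons => /andP[].
Qed.
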